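(* Let $p,k\ge 1$ be integers, and let $\alpha_1,\dots,\alpha_{k+1},\delta\in\mathbb{C}$ satisfy $\Re(\alpha_j)>p-1$ for $j=1,\dots,k+1$ and $\Re(\alpha_{k+1}+\delta)>p-1$. Let $E[\cdot]$ denote the average over the $p\times p$ complex matrix-variate type-2 Dirichlet measure with parameters $(\alpha_1,\dots,\alpha_k;\alpha_{k+1})$, and let $$\phi_5(\tilde X_1,\dots,\tilde X_k)=|\det(I+\tilde X_1+\cdots+\tilde X_k)|^{-\delta}.$$ Then $$E[\phi_5]=\frac{\tilde\Gamma_p(\alpha_{k+1}+\delta)}{\tilde\Gamma_p(\alpha_{k+1})}\,\frac{\tilde\Gamma_p(\alpha_1+\cdots+\alpha_{k+1})}{\tilde\Gamma_p(\alpha_1+\cdots+\alpha_{k+1}+\delta)}.$$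
   Context: For Hermitian matrices, $A>O$ means $A$ is positive definite; $I$ is the $p\times p$ identity. For a $p\times p$ Hermitian matrix variable $\tilde X=(x_{ij}+\mathrm{i}\,y_{ij})$, $d\tilde X=\prod_{i\le j}dx_{ij}\prod_{i<j}dy_{ij}$ (Lebesgue measure in the independent real coordinates). $|\det(\cdot)|$ is the absolute value of the determinant. The complex matrix-variate gamma function is $\tilde\Gamma_p(\alpha)=\pi^{p(p-1)/2}\,\Gamma(\alpha)\Gamma(\alpha-1)\cdots\Gamma(\alpha-(p-1))$ for $\Re(\alpha)>p-1$. The complex matrix-variate type-2 Dirichlet measure with parameters $(\alpha_1,\dots,\alpha_k;\alpha_{k+1})$, $\Re(\alpha_j)>p-1$, has density $$f_2(\tilde X_1,\dots,\tilde X_k)=\tilde D_k\left(\prod_{j=1}^k|\det(\tilde X_j)|^{\alpha_j-p}\right)|\det(I+\tilde X_1+\cdots+\tilde X_k)|^{-(\alpha_1+\cdots+\alpha_{k+1})},\qquad \tilde D_k=\frac{\tilde\Gamma_p(\alpha_1+\cdots+\alpha_{k+1})}{\tilde\Gamma_p(\alpha_1)\cdots\tilde\Gamma_p(\alpha_{k+1})},$$ on the set of $k$-tuples of $p\times p$ Hermitian positive definite matrices $\tilde X_1,\dots,\tilde X_k$. The Dirichlet average of a function $\phi$ is $E[\phi]=\int\phi\,f_2\,d\tilde X_1\cdots d\tilde X_k$. *)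

(* Defs.v *)
From HB Require Import structures.
From mathcomp Require Import all_boot all_order all_algebra.
From mathcomp Require Import all_classical all_reals all_analysis.
From mathcomp Require Import complex.

Set Implicit Arguments.
Unset Strict Implicit.
Unset Printing Implicit Defensive.

Import Order.TTheory GRing.Theory Num.Theory.
Import numFieldNormedType.Exports.

Local Open Scope classical_set_scope.
Local Open Scope ring_scope.
Local Open Scope complex_scope.
Local Open Scope sesquilinear_scope.

(* The n-fold product measure on n.-tuple T is built by recursion on n from    *)
(* binary product measures; power_measure_box below is its characterization.   *)
Section power_measure.
Context d (T : measurableType d) (R : realType).
Variable mu : {sigma_finite_measure set T -> \bar R}.

Section cons_measure.
Variable n : nat.
Variable nu : {sigma_finite_measure set (n.-tuple T) -> \bar R}.

Definition cons_pair (x : T * n.-tuple T) : n.+1.-tuple T :=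
  [tuple of x.1 :: x.2].

Lemma measurable_cons_pair : measurable_fun [set: T * n.-tuple T] cons_pair.
Proof. exact: measurable_cons. Qed.

Definition cons_measure : set (n.+1.-tuple T) -> \bar R :=
  pushforward (mu \x nu)%E cons_pair.

Let cons_measure0 : cons_measure set0 = 0%E.
Proof. by rewrite /cons_measure /pushforward preimage_set0 measure0. Qed.

Let cons_measure_ge0 A : (0 <= cons_measure A)%E.
Proof. by rewrite /cons_measure /pushforward; exact: integral_ge0. Qed.

Let cons_measure_sigma_additive : semi_sigma_additive cons_measure.
Proof.
move=> F mF tF mUF; rewrite /cons_measure /pushforward preimage_bigcup.
have mc := measurable_cons_pair.
apply: measure_semi_sigma_additive.
- by move=> i; rewrite -[X in measurable X]setTI; exact: mc.
- apply/trivIsetP => /= i j _ _ ij; rewrite -preimage_setI.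
  by move/trivIsetP : tF => /(_ _ _ _ _ ij) ->//; rewrite preimage_set0.
- by rewrite -preimage_bigcup -[X in measurable X]setTI; exact: mc.
Qed.

HB.instance Definition _ := isMeasure.Build _ _ _ cons_measure
  cons_measure0 cons_measure_ge0 cons_measure_sigma_additive.

Let cons_measure_sigma_finite : sigma_finite setT cons_measure.
Proof.
have /sigma_finiteP[F [TF ndF Foo]] := sigma_finiteT mu.
have /sigma_finiteP[G [TG ndG Goo]] := sigma_finiteT nu.
pose H k := [set t : n.+1.-tuple T | F k (thead t) /\ G k [tuple of behead t]].
have HE k : cons_pair @^-1` H k = F k `*` G k.
  apply/seteqP; split => -[x t]; rewrite /H /cons_pair /=.
    by move=> [Fx Gt]; split => //=; move: Gt; congr (G k); exact: val_inj.
  by move=> [/= Fx Gt]; split => //; move: Gt; congr (G k); exact: val_inj.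
exists H.
  rewrite predeqE => t; split => // _.
  have [i _ Fi] : (\bigcup_k F k) (thead t) by rewrite -TF.
  have [j _ Gj] : (\bigcup_k G k) [tuple of behead t] by rewrite -TG.
  exists (maxn i j) => //; split.
    by move: Fi; apply/subsetPset/ndF/leq_maxl.
  by move: Gj; apply/subsetPset/ndG/leq_maxr.
move=> k; have [mF Fk] := Foo k; have [mG Gk] := Goo k; split.
  rewrite (_ : H k = (@thead n T @^-1` F k) `&`
     ((fun t : n.+1.-tuple T => [tuple of behead t]) @^-1` G k)) //.
  apply: measurableI; rewrite -[X in measurable X]setTI.
    exact: (@measurable_tnth _ T n.+1 ord0).
  exact: measurable_behead.
rewrite /cons_measure /pushforward HE product_measure1E//.
by rewrite lte_mul_pinfty// ge0_fin_numE.
Qed.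

HB.instance Definition _ := Measure_isSigmaFinite.Build _ _ _ cons_measure
  cons_measure_sigma_finite.

End cons_measure.

Fixpoint power_measure n : {sigma_finite_measure set (n.-tuple T) -> \bar R} :=
  if n is m.+1 then cons_measure (power_measure m) : sigma_finite_measure _ _
  else \d_([tuple] : 0.-tuple T).

Lemma power_measure_box n (A : 'I_n -> set T) :
  (forall i, measurable (A i)) ->
  power_measure n [set t | forall i, A i (tnth t i)] = (\prod_(i < n) mu (A i))%E.
Proof.
elim: n A => [|n IH] A mA.
  by rewrite big_ord0 /= diracE mem_set// => -[].
rewrite big_ord_recl -(IH (fun i => A (lift ord0 i)))//= /cons_measure.
rewrite /pushforward -product_measure1E//.
  congr (_ _); apply/seteqP; split => -[x t]; rewrite /cons_pair /=.
    move=> H; split; first by have := H ord0; rewrite tnth0.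
    by move=> i /=; have := H (lift ord0 i); rewrite tnthS.
  move=> [/= Hx Ht] i; case: (unliftP ord0 i) => [j ->|->].
    by rewrite tnthS; exact: Ht.
  by rewrite tnth0.
rewrite (_ : [set _ | _] =
  \bigcap_(i in [set: 'I_n]) ((fun t => tnth t i) @^-1` A (lift ord0 i))).
  apply: fin_bigcap_measurable => // i _; rewrite -[X in measurable X]setTI.
  exact: measurable_tnth.
by apply/seteqP; split => t /= H i => [_|]; [exact: H|exact: (H i Logic.I)].
Qed.

End power_measure.

Section complex_integral.
Context d (T : measurableType d) (R : realType).
Variables (mu : {measure set T -> \bar R}) (D : set T) (f : T -> R[i]).

Definition cintegrable : Prop :=
  mu.-integrable D (fun x => (complex.Re (f x))%:E) /\
  mu.-integrable D (fun x => (complex.Im (f x))%:E).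

Definition cintegral : R[i] :=
  (\int[mu]_(x in D) complex.Re (f x)) +i* (\int[mu]_(x in D) complex.Im (f x)).

End complex_integral.

Section complex_gamma.
Context {R : realType}.

(* r ^ z = exp (z ln r) for real r > 0; junk for r <= 0. *)
Definition cpow (r : R) (z : R[i]) : R[i] :=
  (expR (complex.Re z * ln r))%:C *
  (cos (complex.Im z * ln r) +i* sin (complex.Im z * ln r)).

(* Euler's integral, meaningful for Re z > 0. *)
Definition cGamma (z : R[i]) : R[i] :=
  cintegral (@lebesgue_measure R) `]0, +oo[%classic
    (fun t : R => cpow t (z - 1) * (expR (- t))%:C).

Definition cmxGamma (p : nat) (a : R[i]) : R[i] :=
  ((pi : R) ^+ (p * p.-1)./2)%:C * \prod_(i < p) cGamma (a - i%:R).

End complex_gamma.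

Section hermitian.
Context {R : realType}.

Definition posdefmx p (A : 'M[R[i]]_p) : Prop :=
  A \is hermsymmx /\
  forall v : 'cV[R[i]]_p, v != 0 -> 0 < (v ^t* *m A *m v) 0 0.

(* |det A| as a real number (the norm of R[i] takes its values in R[i]). *)
Definition absdet p (A : 'M[R[i]]_p) : R := complex.Re `|\det A|.

(* The p ^ 2 independent real coordinates of a Hermitian matrix (x_ij + i y_ij) *)
(* are stored in a square array: x_ij (i <= j) at position (i, j), and y_ij     *)
(* (i < j) at position (j, i).                                                  *)
Definition hermcoord p := p.-tuple (p.-tuple (measurableTypeR R)).

Definition hermmx p (t : hermcoord p) : 'M[R[i]]_p :=
  let c (i j : 'I_p) : R := tnth (tnth t i) j in
  \matrix_(i, j) (if (i < j)%N then c i j +i* c j i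
                  else if (j < i)%N then c j i -i* c i j
                  else (c i i)%:C).

(* d X_1 ... d X_k *)
Definition herm_lebesgue p k :
    {sigma_finite_measure set (k.-tuple (hermcoord p)) -> \bar R} :=
  power_measure (power_measure (power_measure (@lebesgue_measure R) p) p) k.

Definition hermtuple p k (t : k.-tuple (hermcoord p)) : 'I_k -> 'M[R[i]]_p :=
  fun j => hermmx (tnth t j).

Definition posdef_domain p k : set (k.-tuple (hermcoord p)) :=
  [set t | forall j, posdefmx (hermtuple t j)].

End hermitian.

(* alpha : 'I_k.+1 -> R[i] lists alpha_1, ..., alpha_k, alpha_(k+1); the last   *)
(* parameter is alpha ord_max.                                                  *)
Section dirichlet2.
Context {R : realType}.
Variables (p k : nat) (alpha : 'I_k.+1 -> R[i]).

Definition dirichlet2_const : R[i] :=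
  cmxGamma p (\sum_j alpha j) / \prod_j cmxGamma p (alpha j).

Definition dirichlet2_density (X : 'I_k -> 'M[R[i]]_p) : R[i] :=
  dirichlet2_const *
  (\prod_(j < k) cpow (absdet (X j)) (alpha (widen_ord (leqnSn k) j) - p%:R)) *
  cpow (absdet (1%:M + \sum_j X j)) (- \sum_j alpha j).

Definition dirichlet2_integrand (phi : ('I_k -> 'M[R[i]]_p) -> R[i])
    (t : k.-tuple (hermcoord p)) : R[i] :=
  phi (hermtuple t) * dirichlet2_density (hermtuple t).

Definition dirichlet2_integrable phi : Prop :=
  cintegrable (herm_lebesgue p k) (@posdef_domain R p k) (dirichlet2_integrand phi).

Definition dirichlet2_average phi : R[i] :=
  cintegral (herm_lebesgue p k) (@posdef_domain R p k) (dirichlet2_integrand phi).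

End dirichlet2.

Definition phi5 (R : realType) p k (delta : R[i]) (X : 'I_k -> 'M[R[i]]_p) :
    R[i] :=
  cpow (absdet (1%:M + \sum_j X j)) (- delta).

(* Main.v *)
(** For X_1, ..., X_k positive definite, the matrix-variate Gamma integral
      int_(Y > 0) |Y|^(s-p) exp(-tr(A Y)) dY = |A|^(-s) Gamma_p(s)
    with A = I + X_1 + ... + X_k represents |A|^(-s), where s is the sum of all
    the parameters and of delta. Integrating it against the product of the
    |X_j|^(alpha_j - p) and exchanging the integrals gives, by the same formula
    applied to each X_j and then to Y, the product of the Gamma_p(alpha_j),
    j <= k, and of Gamma_p(alpha_(k+1) + delta). It remains to divide by
    Gamma_p(s), which is not zero.

    The matrix-variate Gamma integral is computed by induction on p: for
    Y = [y, v^*; v, W] and A = [a, b^*; b, D], one integrates first over y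
    (Y > 0 iff W > 0 and s := y - v^* W^-1 v > 0, and |Y| = s |W|), then over v
    (a Gaussian integral, after completing the square in
    a v^* W^-1 v + b^* v + v^* b), and then over W, where A is replaced by its
    Schur complement D - b b^* / a. *)

From HB Require Import structures.
Require Import Defs.
From mathcomp Require Import all_boot all_order all_algebra.
From mathcomp Require Import all_classical all_reals all_analysis.
From mathcomp Require Import unstable measurable_realfun complex ring lra.

Set Implicit Arguments.
Unset Strict Implicit.
Unset Printing Implicit Defensive.

Import Order.TTheory GRing.Theory Num.Theory.
Import numFieldNormedType.Exports.

Local Open Scope classical_set_scope.
Local Open Scope ring_scope.
Local Open Scope complex_scope.
Local Open Scope sesquilinear_scope.

(** * Integrals of complex-valued functions *)

(** No Jacobian determinant in several variables is ever computed: coordinates are only regrouped,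
    translated, or rescaled one at a time, and every regrouping is a measure-preserving map. The
    coordinates of a Hermitian matrix are nested so that the corner lies innermost, then the border,
    then the lower block; each integration is then an integral over sections of a product.

    The parameters being complex, every exchange of integrals calls for absolute convergence first.
    The modulus of each kernel is the same kernel at the real parts of its parameters, so the
    formula under proof, read at real parameters, supplies the finite majorant. Hence the statements
    cover all complex parameters at once and carry integrability along with the value.

    That Gamma_p(s) is nonzero reduces to Gamma(z) being nonzero for Re z > 0, an analytic fact: a
    zero at z would be inherited by every z + n, whereas Gamma cannot vanish when the real part is
    large compared with the square of the imaginary part. *)

Section real_integral.
Context d (T : measurableType d) (R : realType).
Variable mu : {measure set T -> \bar R}.
Implicit Types f g : T -> R.

(** Integrability and value travel together: an integral has some value even when the function is
    not integrable, so the equation alone would justify neither linearity nor Fubini. *)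
Definition has_rint f (r : R) :=
  mu.-integrable setT (EFin \o f) /\ (\int[mu]_x (f x)%:E = r%:E)%E.

Lemma has_rint_Rintegral f :
  mu.-integrable setT (EFin \o f) -> has_rint f (\int[mu]_x f x).
Proof.
by move=> fi; split=> //; rewrite /Rintegral fineK//; exact: integrable_fin_num.
Qed.

Lemma has_rint_unique f r s : has_rint f r -> has_rint f s -> r = s.
Proof. by move=> [_ fr] [_]; rewrite fr => -[]. Qed.

Lemma has_rint0 : has_rint (fun=> 0) 0.
Proof. by split; [exact: integrable0|rewrite integral0]. Qed.

Lemma has_rintD f g r s :
  has_rint f r -> has_rint g s -> has_rint (fun x => f x + g x) (r + s).
Proof.
move=> [fi fr] [gi gs]; split; first exact: (integrableD measurableT fi gi).
by under eq_integral do rewrite EFinD; rewrite (integralD measurableT fi gi) fr gs.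
Qed.

Lemma has_rintZ c f r : has_rint f r -> has_rint (fun x => c * f x) (c * r).
Proof.
move=> [fi fr]; split; first exact: (integrableZl measurableT c fi).
by under eq_integral do rewrite EFinM; rewrite (integralZl measurableT fi) fr.
Qed.

Lemma has_rintN f r : has_rint f r -> has_rint (fun x => - f x) (- r).
Proof.
move=> /(has_rintZ (-1)); rewrite mulN1r; congr (has_rint _ _).
by apply/funext => x; rewrite mulN1r.
Qed.

Lemma has_rintB f g r s :
  has_rint f r -> has_rint g s -> has_rint (fun x => f x - g x) (r - s).
Proof. by move=> hf /has_rintN; exact: has_rintD. Qed.

Lemma le_has_rint f g r s : (forall x, f x <= g x) ->
  has_rint f r -> has_rint g s -> r <= s.
Proof.
move=> fg [fi fr] [gi gs]; rewrite -lee_fin -fr -gs.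
by apply: le_integral => // x _; rewrite lee_fin.
Qed.

Lemma has_rint_norm f r : has_rint f r -> exists s, has_rint (fun x => `|f x|) s.
Proof.
by move=> [fi _]; eexists; apply: has_rint_Rintegral; exact: integrable_norm.
Qed.

Lemma has_rint_dom f g s : measurable_fun setT f -> (forall x, `|f x| <= g x) ->
  has_rint g s -> exists r, has_rint f r.
Proof.
move=> mf fg [gi _]; exists (\int[mu]_x f x); apply: has_rint_Rintegral.
apply: (le_integrable measurableT _ _ gi); first exact/measurable_EFinP.
by move=> x _ /=; rewrite lee_fin (le_trans (fg x))// ler_norm.
Qed.

Lemma has_rint_measurable f r : has_rint f r -> measurable_fun setT f.
Proof. by move=> [/measurable_int/measurable_EFinP]. Qed.

Lemma ge0_has_rint f r : measurable_fun setT f -> (forall x, 0 <= f x) ->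
  (\int[mu]_x (f x)%:E = r%:E)%E -> has_rint f r.
Proof.
move=> mf f0 fr; split => //; apply/integrableP; split.
  exact/measurable_EFinP.
under eq_integral do rewrite /= ger0_norm//.
by rewrite fr ltry.
Qed.

End real_integral.

(** * Product measures and Fubini for real functions *)

Section prodm.
Context d1 d2 (T1 : measurableType d1) (T2 : measurableType d2) (R : realType).
Variables (mu : {sigma_finite_measure set T1 -> \bar R}).
Variables (nu : {sigma_finite_measure set T2 -> \bar R}).

(* An alias of the product measure: the unifier finds no sigma-finite instance *)
(* on [_ \x _], where an instance for probability measures comes first.        *)
Definition prodm : set (T1 * T2) -> \bar R := (mu \x nu)%E.

HB.instance Definition _ := Measure.on prodm.

Let prodm_sigma_finite : sigma_finite setT prodm.
Proof.
have /sigma_finiteP[F [TF ndF Foo]] := sigma_finiteT mu.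
have /sigma_finiteP[G [TG ndG Goo]] := sigma_finiteT nu.
exists (fun n => F n `*` G n).
  rewrite -setXTT TF TG predeqE => -[x y]; split.
    move=> [/= [n _ Fnx] [k _ Gky]]; exists (maxn n k) => //; split.
    - by move: x Fnx; exact/subsetPset/ndF/leq_maxl.
    - by move: y Gky; exact/subsetPset/ndG/leq_maxr.
  by move=> [n _ []/= ? ?]; split; exists n.
move=> k; have [? ?] := Foo k; have [? ?] := Goo k; split.
  exact: measurableX.
by rewrite /prodm product_measure1E// lte_mul_pinfty// ge0_fin_numE.
Qed.

HB.instance Definition _ := Measure_isSigmaFinite.Build _ _ _ prodm prodm_sigma_finite.

End prodm.

Section real_fubini.
Context d1 d2 (T1 : measurableType d1) (T2 : measurableType d2) (R : realType).
Variables (mu : {sigma_finite_measure set T1 -> \bar R}).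
Variables (nu : {sigma_finite_measure set T2 -> \bar R}).
Implicit Types (f : T1 * T2 -> R) (g : T1 -> R).

(** Tonelli applied to [|f|], whose inner integral is at most [H], gives integrability for the
    product; Fubini then identifies the value with the iterated integral of [f]. *)
Lemma has_rint_prod f (N : T1 * T2 -> R) g (H : T1 -> R) h v :
  measurable_fun setT f -> (forall z, `|f z| <= N z) ->
  (forall x, has_rint nu (fun y => N (x, y)) (H x)) -> has_rint mu H h ->
  (forall x, has_rint nu (fun y => f (x, y)) (g x)) -> has_rint mu g v ->
  has_rint (prodm mu nu) f v.
Proof.
move=> mf fN NH Hh fg gv.
have mef : measurable_fun setT (EFin \o f) by exact/measurable_EFinP.
have fi : (mu \x nu)%E.-integrable setT (EFin \o f).
  apply/integrable12ltyP => //.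
  apply: (@le_lt_trans _ _ (\int[mu]_x (H x)%:E)%E); last by rewrite Hh.2 ltry.
  apply: ge0_le_integral => //.
  - by move=> x _; exact: integral_ge0.
  - apply: (measurable_fun_fubini_tonelli_F (abse \o (EFin \o f))) => //=.
    exact: measurableT_comp.
  - by apply/measurable_EFinP; exact: has_rint_measurable Hh.
  - move=> x _; rewrite -(NH x).2; apply: ge0_le_integral => //.
    + apply: measurableT_comp => //.
      apply: (measurableT_comp mef); exact: measurable_pair1.
    + by apply/measurable_EFinP; exact: has_rint_measurable (NH x).
    + by move=> y _; rewrite lee_fin.
split=> //; rewrite -(integral12_prod_meas1 fi) -gv.2.
by apply: eq_integral => x _; exact: (fg x).2.
Qed.

(** The opposite direction to [has_rint_prod]: integrability of the inner integral is inherited from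
    the product. This is how the integrand of the Dirichlet average is shown to be integrable. *)
Lemma has_rint_sections f g v : has_rint (prodm mu nu) f v ->
  (forall x, has_rint nu (fun y => f (x, y)) (g x)) -> has_rint mu g v.
Proof.
move=> [fi fv] fg.
have E : (EFin \o g) = (fun x => \int[nu]_y (f (x, y))%:E)%E.
  by apply/funext => x /=; apply/esym/(fg x).2.
split; first by rewrite E; exact: (integrable_fubini_F fi).
rewrite -fv -(integral12_prod_meas1 fi); apply: eq_integral => x _.
exact/esym/(fg x).2.
Qed.

End real_fubini.

Section complex_integral_theory.
Context d (T : measurableType d) (R : realType).
Variable mu : {measure set T -> \bar R}.
Implicit Types (f g : T -> R[i]).

Definition cmeasurable f := measurable_fun setT (fun x => complex.Re (f x)) /\
  measurable_fun setT (fun x => complex.Im (f x)).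

(** Always over the whole space: a domain of integration appears as an indicator factor of the
    integrand, so that Fubini and substitutions need no bookkeeping of domains. *)
Definition has_cint f (v : R[i]) :=
  has_rint mu (fun x => complex.Re (f x)) (complex.Re v) /\
  has_rint mu (fun x => complex.Im (f x)) (complex.Im v).

Lemma has_cint_measurable f v : has_cint f v -> cmeasurable f.
Proof. by move=> [/has_rint_measurable ? /has_rint_measurable ?]. Qed.

Lemma eq_has_cint f g v : f =1 g -> has_cint f v -> has_cint g v.
Proof. by move=> /funext ->. Qed.

Lemma has_cint0 : has_cint (fun=> 0) 0.
Proof. by split; exact: has_rint0. Qed.

Lemma has_cintZ c f v : has_cint f v -> has_cint (fun x => c * f x) (c * v).
Proof.
case: c v => [a b] [v w] [/= hr hi]; split=> /=.
- have := has_rintB (has_rintZ a hr) (has_rintZ b hi).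
  by congr has_rint; apply/funext => x; case: (f x).
- have := has_rintD (has_rintZ a hi) (has_rintZ b hr).
  by congr has_rint; apply/funext => x; case: (f x).
Qed.

Lemma has_cintZr c f v : has_cint f v -> has_cint (fun x => f x * c) (v * c).
Proof. by move=> /(has_cintZ c) h; rewrite mulrC; apply: eq_has_cint h => x; rewrite mulrC. Qed.

Lemma has_cintD f g v w : has_cint f v -> has_cint g w ->
  has_cint (fun x => f x + g x) (v + w).
Proof.
move: v w => [v v'] [w w'] [/= a b] [/= a' b']; split=> /=.
  have := has_rintD a a'.
  by congr has_rint; apply/funext => x; case: (f x); case: (g x).
have := has_rintD b b'.
by congr has_rint; apply/funext => x; case: (f x); case: (g x).
Qed.

Lemma has_cintB f g v w : has_cint f v -> has_cint g w ->
  has_cint (fun x => f x - g x) (v - w).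
Proof.
move=> hf /(has_cintZ (-1)) /(has_cintD hf); rewrite mulN1r.
by apply: eq_has_cint => x; rewrite mulN1r.
Qed.

Lemma has_cint_real (f : T -> R) (r : R) :
  has_rint mu f r <-> has_cint (fun x => (f x)%:C) r%:C.
Proof. by split=> [h|[]//]; split=> //=; exact: has_rint0. Qed.

(** The bridge back to integrals over a domain, as they occur in the definitions of the Gamma
    function and of the Dirichlet average. *)
Lemma cintegral_restrict (D : set T) f v : measurable D ->
  has_cint (fun x => (\1_D x)%:C * f x) v ->
  cintegrable mu D f /\ cintegral mu D f = v.
Proof.
move=> mD; case: v => v w [/= [ri rv] [ii iv]].
have Er : ((fun x => (complex.Re (f x))%:E) \_ D) =
    EFin \o (fun x => complex.Re ((\1_D x)%:C * f x)).
  apply/funext => x /=; rewrite patchE indicE; case: ifP => _; case: (f x) => a b /=.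
    by rewrite mul1r mul0r subr0.
  by rewrite !mul0r subr0.
have Ei : ((fun x => (complex.Im (f x))%:E) \_ D) =
    EFin \o (fun x => complex.Im ((\1_D x)%:C * f x)).
  apply/funext => x /=; rewrite patchE indicE; case: ifP => _; case: (f x) => a b /=.
    by rewrite mul1r mul0r addr0.
  by rewrite !mul0r addr0.
split.
  by split; apply/(integrable_mkcond _ mD); rewrite ?Er ?Ei.
rewrite /cintegral /Rintegral (integral_mkcond D) Er.
by rewrite (integral_mkcond D) Ei /= rv iv.
Qed.

(** The modulus as an element of [R]; the norm of [R[i]] takes its values in [R[i]]. *)
Definition Renorm (z : R[i]) : R := complex.Re `|z|.

Lemma RenormE z : (Renorm z)%:C = `|z|.
Proof. by rewrite /Renorm normc_def. Qed.

Lemma Renorm_sqrt z : Renorm z = Num.sqrt (complex.Re z ^+ 2 + complex.Im z ^+ 2).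
Proof. by rewrite /Renorm normc_def. Qed.

Lemma Renorm_ge0 z : 0 <= Renorm z.
Proof. by rewrite Renorm_sqrt sqrtr_ge0. Qed.

Lemma Renorm_ge_Re z : `|complex.Re z| <= Renorm z.
Proof. by rewrite -lecR RenormE normc_ge_Re. Qed.

Lemma Renorm_ge_Im z : `|complex.Im z| <= Renorm z.
Proof. by rewrite Renorm_sqrt -sqrtr_sqr ler_sqrt ?lerDr ?sqr_ge0// addr_ge0 ?sqr_ge0. Qed.

Lemma Renorm_le z : Renorm z <= `|complex.Re z| + `|complex.Im z|.
Proof.
have h : 0 <= `|complex.Re z| + `|complex.Im z| by rewrite addr_ge0.
rewrite Renorm_sqrt -(ger0_norm h) -sqrtr_sqr ler_sqrt ?sqr_ge0//.
rewrite sqrrD -!normrX !(ger0_norm (sqr_ge0 _)) addrAC lerDl.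
by rewrite mulrn_wge0// mulr_ge0.
Qed.

Lemma measurable_Renorm f : cmeasurable f -> measurable_fun setT (fun x => Renorm (f x)).
Proof.
move=> [mr mi]; rewrite (_ : (fun x => _) =
    (fun x => Num.sqrt (complex.Re (f x) ^+ 2 + complex.Im (f x) ^+ 2))).
  apply: (measurableT_comp (continuous_measurable_fun (@sqrt_continuous R))).
  by apply: measurable_funD; apply: measurable_funX.
by apply/funext => x; rewrite Renorm_sqrt.
Qed.

Lemma has_cint_norm f v : has_cint f v ->
  exists r, has_rint mu (fun x => Renorm (f x)) r.
Proof.
move=> hf; have mf := measurable_Renorm (has_cint_measurable hf).
case: hf => /has_rint_norm[r hr] /has_rint_norm[s hs].
apply: (has_rint_dom mf _ (has_rintD hr hs)) => x.
by rewrite ger0_norm ?Renorm_ge0 ?Renorm_le.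
Qed.

Lemma le_has_cint_norm f (g : T -> R) v r : (forall x, Renorm (f x) <= g x) ->
  has_cint f v -> has_rint mu g r -> Renorm v <= r.
Proof.
(* rotate v onto the nonnegative real axis *)
move=> fg hf hg.
have [->|v0] := eqVneq v 0.
  rewrite /Renorm normr0; apply: le_has_rint (has_rint0 mu) hg => x.
  exact: le_trans (Renorm_ge0 _) (fg x).
have := has_cintZ (v^* / `|v|) hf.
have -> : v^* / `|v| * v = (Renorm v)%:C.
  rewrite RenormE mulrAC (mulrC v^*) -sqr_normc expr2 mulfK// ?normr_eq0//.
move=> [/= h _]; apply: le_has_rint h hg => x.
apply: le_trans (fg x); apply: le_trans (ler_norm _) _.
apply: le_trans (Renorm_ge_Re _) _; rewrite -lecR !RenormE normrM normrM.
by rewrite normfV normr_id normcJ mulfV ?normr_eq0// mul1r.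
Qed.

Lemma cmeasurableM f g : cmeasurable f -> cmeasurable g ->
  cmeasurable (fun x => f x * g x).
Proof.
move=> [fr fi] [gr gi]; split.
- rewrite (_ : (fun x => _) = (fun x => complex.Re (f x) * complex.Re (g x) -
     complex.Im (f x) * complex.Im (g x))).
    by apply: measurable_funB; apply: measurable_funM.
  by apply/funext => x; case: (f x); case: (g x).
- rewrite (_ : (fun x => _) = (fun x => complex.Re (f x) * complex.Im (g x) +
     complex.Im (f x) * complex.Re (g x))).
    by apply: measurable_funD; apply: measurable_funM.
  by apply/funext => x; case: (f x) => ? ?; case: (g x).
Qed.

Lemma cmeasurableD f g : cmeasurable f -> cmeasurable g ->
  cmeasurable (fun x => f x + g x).
Proof.
move=> [fr fi] [gr gi]; split.
- rewrite (_ : (fun x => _) = (fun x => complex.Re (f x) + complex.Re (g x))).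
    by apply: measurable_funD.
  by apply/funext => x; case: (f x); case: (g x).
- rewrite (_ : (fun x => _) = (fun x => complex.Im (f x) + complex.Im (g x))).
    by apply: measurable_funD.
  by apply/funext => x; case: (f x) => ? ?; case: (g x).
Qed.

Lemma cmeasurable_cst c : cmeasurable (fun=> c).
Proof. by split; exact: measurable_cst. Qed.

Lemma cmeasurable_real (f : T -> R) : measurable_fun setT f ->
  cmeasurable (fun x => (f x)%:C).
Proof. by move=> mf; split=> //=; exact: measurable_cst. Qed.

Lemma cmeasurable_sum (I : Type) (s : seq I) (P : pred I) (F : I -> T -> R[i]) :
  (forall i, cmeasurable (F i)) -> cmeasurable (fun x => \sum_(i <- s | P i) F i x).
Proof.
move=> mF; elim: s => [|i s ih].
  by under eq_fun do rewrite big_nil; exact: cmeasurable_cst.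
under eq_fun do rewrite big_cons; case: (P i) => //.
exact: cmeasurableD.
Qed.

Lemma cmeasurable_prod (I : Type) (s : seq I) (P : pred I) (F : I -> T -> R[i]) :
  (forall i, cmeasurable (F i)) -> cmeasurable (fun x => \prod_(i <- s | P i) F i x).
Proof.
move=> mF; elim: s => [|i s ih].
  by under eq_fun do rewrite big_nil; exact: cmeasurable_cst.
under eq_fun do rewrite big_cons; case: (P i) => //.
exact: cmeasurableM.
Qed.

End complex_integral_theory.

Lemma cmeasurable_comp d d' (T : measurableType d) (U : measurableType d')
    (R : realType) (f : U -> R[i]) (phi : T -> U) : measurable_fun setT phi ->
  cmeasurable f -> cmeasurable (fun x => f (phi x)).
Proof.
by move=> mphi [fr fi]; split; [apply: (measurableT_comp fr)|apply: (measurableT_comp fi)].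
Qed.

Section complex_fubini.
Context d1 d2 (T1 : measurableType d1) (T2 : measurableType d2) (R : realType).
Variables (mu : {sigma_finite_measure set T1 -> \bar R}).
Variables (nu : {sigma_finite_measure set T2 -> \bar R}).

(* F0 is meant to be F with its complex parameters replaced by their real parts: *)
(* the iterated integrals of F0 are then instances of those of F, and they give  *)
(* the absolute convergence.                                                     *)
Lemma has_cint_prod (F F0 : T1 * T2 -> R[i]) (G G0 : T1 -> R[i]) v v0 :
  cmeasurable F -> (forall z, `|F z| = F0 z) ->
  (forall x, has_cint nu (fun y => F0 (x, y)) (G0 x)) -> has_cint mu G0 v0 ->
  (forall x, has_cint nu (fun y => F (x, y)) (G x)) -> has_cint mu G v ->
  has_cint (prodm mu nu) F v.
Proof.
move=> [mFr mFi] FF0 FG0 [G0v _] FG Gv.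
split.
- apply: (@has_rint_prod _ _ _ _ _ mu nu _ (fun z => complex.Re (F0 z)) _ _ _ _ mFr).
  + by move=> z; rewrite -FF0; exact: Renorm_ge_Re.
  + by move=> x; exact: (FG0 x).1.
  + exact: G0v.
  + by move=> x; exact: (FG x).1.
  + exact: Gv.1.
- apply: (@has_rint_prod _ _ _ _ _ mu nu _ (fun z => complex.Re (F0 z)) _ _ _ _ mFi).
  + by move=> z; rewrite -FF0; exact: Renorm_ge_Im.
  + by move=> x; exact: (FG0 x).1.
  + exact: G0v.
  + by move=> x; exact: (FG x).2.
  + exact: Gv.2.
Qed.

Lemma has_cint_sections (F : T1 * T2 -> R[i]) (G : T1 -> R[i]) v :
  has_cint (prodm mu nu) F v ->
  (forall x, has_cint nu (fun y => F (x, y)) (G x)) -> has_cint mu G v.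
Proof.
move=> [Fr Fi] FG; split.
  by apply: has_rint_sections Fr _ => x; exact: (FG x).1.
by apply: has_rint_sections Fi _ => x; exact: (FG x).2.
Qed.

Lemma has_cint_tensor (f : T1 -> R[i]) (g : T2 -> R[i]) v w :
  has_cint mu f v -> has_cint nu g w ->
  has_cint (prodm mu nu) (fun z => f z.1 * g z.2) (v * w).
Proof.
move=> hf hg; have [r hr] := has_cint_norm hf; have [s hs] := has_cint_norm hg.
apply: (@has_cint_prod _ (fun z => `|f z.1| * `|g z.2|)
  (fun x => f x * w) (fun x => `|f x| * s%:C) _ (r%:C * s%:C)).
- apply: cmeasurableM.
    exact: (cmeasurable_comp measurable_fst (has_cint_measurable hf)).
  exact: (cmeasurable_comp measurable_snd (has_cint_measurable hg)).
- by move=> z; rewrite normrM.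
- move=> x /=; apply: has_cintZ; apply: eq_has_cint ((has_cint_real _ _ _).1 hs).
  by move=> y; rewrite RenormE.
- apply: has_cintZr; apply: eq_has_cint ((has_cint_real _ _ _).1 hr).
  by move=> y; rewrite RenormE.
- by move=> x /=; exact: has_cintZ.
- exact: has_cintZr.
Qed.

End complex_fubini.

(** * Measure-preserving maps *)

Lemma tnth_lift0 (T : Type) n (t : n.+1.-tuple T) (i : 'I_n) :
  tnth t (lift ord0 i) = tnth [tuple of behead t] i.
Proof. by rewrite {1}(tuple_eta t) tnthS. Qed.

Section measure_preserving.
Context {R : realType}.

Section defs.
Context d d' (T : measurableType d) (U : measurableType d').
Variables (mu : {measure set T -> \bar R}) (nu : {measure set U -> \bar R}).

Definition mpreserving (phi : T -> U) := measurable_fun setT phi /\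
  forall A, measurable A -> nu A = mu (phi @^-1` A).

Variable phi : T -> U.
Hypothesis phiP : mpreserving phi.

Lemma has_rint_mpreserving (f : U -> R) r : measurable_fun setT f ->
  has_rint mu (f \o phi) r -> has_rint nu f r.
Proof.
move=> mf [fi fr]; have [mphi E] := phiP.
have mef : measurable_fun setT (EFin \o f) by exact/measurable_EFinP.
have pi : (pushforward mu phi).-integrable setT (EFin \o f).
  exact: integrable_pushforward.
have Er : (\int[nu]_x (f x)%:E = r%:E)%E.
  rewrite -fr -(preimage_setT phi) -(@integral_pushforward _ _ _ _ _ _ mphi mu setT (EFin \o f))//.
  by apply: eq_measure_integral => A mA _; rewrite E.
split => //; apply/integrableP; split => //.
case/integrableP : pi => _; apply: le_lt_trans.
have -> // : (\int[nu]_x `|(EFin \o f) x| = \int[pushforward mu phi]_x `|(EFin \o f) x|)%E.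
by apply: eq_measure_integral => A mA _; rewrite E.
Qed.

Lemma has_cint_mpreserving (f : U -> R[i]) v : cmeasurable f ->
  has_cint mu (f \o phi) v -> has_cint nu f v.
Proof. by move=> [mr mi] [/= hr hi]; split; apply: has_rint_mpreserving. Qed.

End defs.

Lemma mpreserving_comp d1 d2 d3 (T1 : measurableType d1) (T2 : measurableType d2)
    (T3 : measurableType d3) (m1 : {measure set T1 -> \bar R})
    (m2 : {measure set T2 -> \bar R}) (m3 : {measure set T3 -> \bar R}) phi psi :
  mpreserving m1 m2 phi -> mpreserving m2 m3 psi -> mpreserving m1 m3 (psi \o phi).
Proof.
move=> [mphi E1] [mpsi E2]; split; first exact: measurableT_comp.
by move=> A mA; rewrite E2// E1// -[X in measurable X]setTI; exact: mpsi.
Qed.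

(** Pulling [A] back through [psi] and then through [phi] returns [A], so a one-sided inverse
    suffices to carry the measure back. *)
Lemma mpreserving_can d1 d2 (T1 : measurableType d1) (T2 : measurableType d2)
    (m1 : {measure set T1 -> \bar R}) (m2 : {measure set T2 -> \bar R}) phi psi :
  mpreserving m1 m2 phi -> measurable_fun setT psi -> cancel phi psi ->
  mpreserving m2 m1 psi.
Proof.
move=> [mphi E] mpsi can; split=> // A mA.
rewrite E; last by rewrite -[X in measurable X]setTI; exact: mpsi.
by congr (m1 _); apply/seteqP; split=> x /=; rewrite can.
Qed.

Lemma mpreserving_id d1 (T1 : measurableType d1) (m1 : {measure set T1 -> \bar R}) :
  mpreserving m1 m1 id.
Proof. by split. Qed.

(** Presents the pushforward as an anonymous measure, in the form expected by the uniqueness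
    theorems for product and Lebesgue measures. *)
Lemma pushforward_measure_exists d1 d2 (T1 : measurableType d1) (T2 : measurableType d2)
    (m : {measure set T1 -> \bar R}) (phi : T1 -> T2) : measurable_fun setT phi ->
  exists m' : {measure set T2 -> \bar R}, forall A, m' A = m (phi @^-1` A).
Proof. by move=> mphi; unshelve eexists (pushforward m phi : {measure set T2 -> \bar R}). Qed.

Section prod.
Context d1 d2 d3 d4 (T1 : measurableType d1) (T2 : measurableType d2)
  (T3 : measurableType d3) (T4 : measurableType d4).
Variables (m1 : {sigma_finite_measure set T1 -> \bar R})
  (m2 : {sigma_finite_measure set T2 -> \bar R})
  (m3 : {sigma_finite_measure set T3 -> \bar R})
  (m4 : {sigma_finite_measure set T4 -> \bar R}).

Lemma mpreserving_prod phi psi : mpreserving m1 m3 phi -> mpreserving m2 m4 psi ->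
  mpreserving (prodm m1 m2) (prodm m3 m4) (fun z => (phi z.1, psi z.2)).
Proof.
move=> [mphi E1] [mpsi E2].
have mm : measurable_fun setT (fun z : T1 * T2 => (phi z.1, psi z.2)).
  apply: measurable_fun_pair; first exact: measurableT_comp.
  exact: measurableT_comp.
split=> // A mA.
have [m' m'E] := pushforward_measure_exists (m1 \x m2)%E mm.
rewrite -m'E; apply: product_measure_unique => // B C mB mC.
rewrite m'E E1// E2// -product_measure1E//.
  by rewrite -[X in measurable X]setTI; exact: mphi.
by rewrite -[X in measurable X]setTI; exact: mpsi.
Qed.

Lemma mpreserving_swap : mpreserving (prodm m1 m2) (prodm m2 m1) (@swap T1 T2).
Proof.
split; first exact: measurable_swap.
move=> A mA; have [m' m'E] := pushforward_measure_exists (m1 \x m2)%E (@measurable_swap _ _ T1 T2).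
rewrite -m'E; apply: product_measure_unique => // B C mB mC.
rewrite m'E muleC -product_measure1E//; congr ((m1 \x m2)%E _).
by apply/seteqP; split=> -[x y] /= [].
Qed.

Definition prodA (z : T1 * (T2 * T3)) : (T1 * T2) * T3 := ((z.1, z.2.1), z.2.2).

Definition prodA' (z : (T1 * T2) * T3) : T1 * (T2 * T3) := (z.1.1, (z.1.2, z.2)).

Lemma mpreserving_prodA : mpreserving (prodm m1 (prodm m2 m3)) (prodm (prodm m1 m2) m3) prodA.
Proof.
have mm : measurable_fun setT prodA.
  apply: measurable_fun_pair; last exact: (measurableT_comp measurable_snd measurable_snd).
  apply: measurable_fun_pair; first exact: measurable_fst.
  exact: (measurableT_comp measurable_fst measurable_snd).
split=> // A mA.
have mpA : measurable (prodA @^-1` A) by rewrite -[X in measurable X]setTI; exact: mm.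
(* Both sides integrate the [m3]-measure of a section of [A]; Tonelli splits the integral over the
   product of [m1] and [m2], and taking sections at x and then at y is taking the section at (x,
   y). *)
transitivity (\int[m1]_x \int[m2]_y m3 (xsection A (x, y)))%E.
  apply: (fubini_tonelli1 (m3 \o xsection A)) => //=.
  exact: measurable_fun_xsection.
apply: eq_integral => x _; apply: eq_integral => y _ /=.
congr (m3 _); apply/seteqP; split=> z /=; rewrite /xsection /= !inE//=.
  by rewrite inE.
by rewrite inE.
Qed.

Lemma mpreserving_prodA' : mpreserving (prodm (prodm m1 m2) m3) (prodm m1 (prodm m2 m3)) prodA'.
Proof.
apply: (mpreserving_can mpreserving_prodA); last by case=> ? [].
apply: measurable_fun_pair; first exact: (measurableT_comp measurable_fst measurable_fst).
apply: measurable_fun_pair; last exact: measurable_snd.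
exact: (measurableT_comp measurable_snd measurable_fst).
Qed.

End prod.
Lemma eq_mpreserving d1 d2 (T1 : measurableType d1) (T2 : measurableType d2)
    (m1 : {measure set T1 -> \bar R}) (m2 : {measure set T2 -> \bar R}) phi psi :
  phi =1 psi -> mpreserving m1 m2 phi -> mpreserving m1 m2 psi.
Proof. by move=> /funext ->. Qed.

(** Transposes a two by two arrangement of factors. It lets two tuples be extended simultaneously,
    which is the induction step for [zip_with] and for pairs of real and imaginary parts. *)
Lemma mpreserving_interchange d1 d2 d3 d4 (T1 : measurableType d1)
    (T2 : measurableType d2) (T3 : measurableType d3) (T4 : measurableType d4)
    (m1 : {sigma_finite_measure set T1 -> \bar R})
    (m2 : {sigma_finite_measure set T2 -> \bar R})
    (m3 : {sigma_finite_measure set T3 -> \bar R})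
    (m4 : {sigma_finite_measure set T4 -> \bar R}) :
  mpreserving (prodm (prodm m1 m2) (prodm m3 m4)) (prodm (prodm m1 m3) (prodm m2 m4))
    (fun z => ((z.1.1, z.2.1), (z.1.2, z.2.2))).
Proof.
have A1 := mpreserving_prodA' m1 m2 (prodm m3 m4).
have A2 := mpreserving_prod (mpreserving_id m1) (mpreserving_prodA m2 m3 m4).
have A3 := mpreserving_prod (mpreserving_id m1)
  (mpreserving_prod (mpreserving_swap m2 m3) (mpreserving_id m4)).
have A4 := mpreserving_prod (mpreserving_id m1) (mpreserving_prodA' m3 m2 m4).
have A5 := mpreserving_prodA m1 m3 (prodm m2 m4).
apply: eq_mpreserving (mpreserving_comp A1 (mpreserving_comp A2
  (mpreserving_comp A3 (mpreserving_comp A4 A5)))).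
by case=> [[a b] [c e]].
Qed.

Section tuples.
Context d (T : measurableType d).
Variable mu : {sigma_finite_measure set T -> \bar R}.

Definition uncons n (t : n.+1.-tuple T) : T * n.-tuple T :=
  (thead t, [tuple of behead t]).

Lemma cons_pairK n : cancel (@cons_pair d T n) (@uncons n).
Proof. by move=> [x t]; congr pair; exact: val_inj. Qed.

Lemma mpreserving_cons n :
  mpreserving (prodm mu (power_measure mu n)) (power_measure mu n.+1) (@cons_pair d T n).
Proof. by split=> //; exact: measurable_cons_pair. Qed.

Lemma measurable_uncons n : measurable_fun setT (@uncons n).
Proof.
apply: measurable_fun_pair; last exact: measurable_behead.
exact: (@measurable_tnth _ T n.+1 ord0).
Qed.

Lemma mpreserving_uncons n :
  mpreserving (power_measure mu n.+1) (prodm mu (power_measure mu n)) (@uncons n).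
Proof.
exact: mpreserving_can (mpreserving_cons n) (@measurable_uncons n) (@cons_pairK n).
Qed.

End tuples.

Section zip.
Context d1 d2 d3 (T : measurableType d1) (U : measurableType d2) (V : measurableType d3).
Variables (mu : {sigma_finite_measure set T -> \bar R})
  (nu : {sigma_finite_measure set U -> \bar R})
  (rho : {sigma_finite_measure set V -> \bar R}).
Variables (phi : T * U -> V).

Definition zip_with n (z : n.-tuple T * n.-tuple U) : n.-tuple V :=
  [tuple phi (tnth z.1 i, tnth z.2 i) | i < n].

(** Used with [phi] equal to [cons_pair], where it prepends a column to a square array of
    coordinates. *)
Lemma mpreserving_zip_with n : mpreserving (prodm mu nu) rho phi ->
  mpreserving (prodm (power_measure mu n) (power_measure nu n)) (power_measure rho n)
    (@zip_with n).
Proof.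
move=> phiP; elim: n => [|n ih].
  have mz : measurable_fun setT (@zip_with 0).
    by apply/measurable_fun_tnthP => -[].
  split=> // A mA; rewrite /= diracE /prodm.
  have [h|h] := boolP ([tuple] \in A).
    have -> : @zip_with 0 @^-1` A = setT `*` setT.
      apply/seteqP; split=> -[x y] // _ /=; rewrite (tuple0 (zip_with (x, y))).
      exact: set_mem.
    by rewrite product_measure1E//= !diracE !mem_setT mule1.
  have -> : @zip_with 0 @^-1` A = set0.
    apply/seteqP; split=> -[x y] //=; rewrite (tuple0 (zip_with (x, y))).
    by move/mem_set; apply/negP.
  by rewrite measure0.
have H := mpreserving_comp (mpreserving_prod (mpreserving_uncons mu n) (mpreserving_uncons nu n))
  (mpreserving_comp (mpreserving_interchange mu (power_measure mu n) nu (power_measure nu n))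
  (mpreserving_comp (mpreserving_prod phiP ih) (mpreserving_cons rho n))).
apply: eq_mpreserving H => -[x y]; apply: eq_from_tnth => i.
case: (unliftP ord0 i) => [j ->|->].
  by rewrite /cons_pair /= tnthS !tnth_mktuple /= !tnth_lift0.
by rewrite tnth0 tnth_mktuple.
Qed.

End zip.

End measure_preserving.

(** * Affine substitutions on the line and translations of tuples *)

Section affine.
Context {R : realType}.
Local Notation leb := (@lebesgue_measure R).
Local Notation RR := (measurableTypeR R).

(** A dilation of the line preserves measure only between Lebesgue measure and a multiple of it;
    this removes the multiple afterwards. *)
Lemma has_rint_mscale d (T : measurableType d) (mu : {measure set T -> \bar R})
    (k : {nonneg R}) (f : T -> R) r : k%:num != 0 ->
  has_rint (mscale k mu) f r -> has_rint mu f (r / k%:num).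
Proof.
move=> k0 [fi fr]; have kp : 0 < k%:num by rewrite lt_neqAle eq_sym k0 /=.
have mf : measurable_fun setT (EFin \o f) by exact: measurable_int fi.
have fi' : mu.-integrable setT (EFin \o f).
  apply/integrableP; split => //; case/integrableP : fi => _.
  rewrite ge0_integral_mscale//; last by apply: measurableT_comp.
  have I0 : (0 <= \int[mu]_x `|(EFin \o f) x|)%E by exact: integral_ge0.
  move: I0; case: (\int[mu]_x `|(EFin \o f) x|)%E => [s||]//= _; rewrite ?ltry//.
  by rewrite gt0_muley ?lte_fin.
split=> //.
have [s hs] : exists s, (\int[mu]_x (f x)%:E = s%:E)%E.
  by exists (fine (\int[mu]_x (f x)%:E)); rewrite fineK//; exact: integrable_fin_num fi'.
rewrite hs; congr EFin; apply: (mulIf k0); rewrite divfK//.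
apply: EFin_inj; rewrite -fr mulrC EFinM -hs.
rewrite integralE [in RHS]integralE.
rewrite !ge0_integral_mscale//; [|exact: measurable_funeneg|exact: measurable_funepos].
rewrite muleBr// fin_num_adde_defr//.
exact: integrable_pos_fin_num.
Qed.

(** The right-hand side is a measure in [A] with the correct value on every interval []c, e]], and
    these intervals determine Lebesgue measure. *)
Lemma lebesgue_measure_affine (a b : R) (A : set RR) : 0 < a -> measurable A ->
  leb A = (a%:E * leb ((fun x : RR => (x * a + b)%R : RR) @^-1` A))%E.
Proof.
move=> a0 mA.
pose k : {nonneg R} := NngNum (ltW a0).
have mphi : measurable_fun setT (fun x : RR => x * a + b : RR).
  have mphi : measurable_fun setT (fun x : RR => x * a + b).
    by apply: measurable_funD => //; apply: measurable_funM.
  exact: mphi.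
have [m' m'E] := pushforward_measure_exists leb mphi.
rewrite -m'E -[RHS]/(mscale k m' A).
apply: (@lebesgue_measure_unique R (mscale k m')) => // X [[c e] _ <-] /=.
rewrite /mscale/= m'E.
have -> : (fun x => x * a + b) @^-1` `]c, e] = `](c - b) / a, (e - b) / a]%classic.
  by apply/seteqP; split=> x /=; rewrite !in_itv/= ltr_pdivrMr// ler_pdivlMr// ltrBlDr lerBrDr.
have L := @lebesgue_measure_itv R `](c - b) / a, (e - b) / a].
rewrite lebesgue_measure_itv/= [X in _ = (_ * X)%E]L/= !lte_fin ltr_pM2r ?invr_gt0// ltrD2r.
case: ifPn => _; last by rewrite mule0.
rewrite -EFinB -EFinB -EFinM; congr EFin; field; exact: lt0r_neq0.
Qed.

Lemma has_rint_affine (f : R -> R) r (a b : R) : 0 < a -> has_rint leb f r ->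
  has_rint leb (fun x => f (x * a + b)) (r / a).
Proof.
move=> a0 hf; pose k : {nonneg R} := NngNum (ltW a0).
have ak : a = k%:num by [].
rewrite [in X in has_rint _ _ X]ak; apply: has_rint_mscale; first by rewrite /= gt_eqF.
have mphi : measurable_fun setT (fun x : RR => x * a + b : RR).
  have mphi : measurable_fun setT (fun x : RR => x * a + b).
    by apply: measurable_funD => //; apply: measurable_funM.
  exact: mphi.
have mpsi : measurable_fun setT (fun x : RR => (x - b) / a : RR).
  have mpsi : measurable_fun setT (fun x : RR => (x - b) / a).
    by apply: measurable_funM => //; apply: measurable_funB.
  exact: mpsi.
have P : mpreserving (mscale k leb) leb (fun x : RR => x * a + b : RR).
  split=> // A mA; apply: etrans (lebesgue_measure_affine b a0 mA) _. by [].
have Q : mpreserving leb (mscale k leb) (fun x : RR => (x - b) / a : RR).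
  by apply: mpreserving_can P mpsi _ => x; rewrite addrK mulfK ?gt_eqF.
apply: (has_rint_mpreserving Q).
  exact: (measurableT_comp (has_rint_measurable hf) mphi).
rewrite (_ : _ \o _ = f)//; apply/funext => x /=.
by rewrite divfK ?gt_eqF// subrK.
Qed.

Lemma has_cint_affine (f : R -> R[i]) v (a b : R) : 0 < a -> has_cint leb f v ->
  has_cint leb (fun x => f (x * a + b)) (v / a%:C).
Proof.
move=> a0 [hr hi].
have -> : v / a%:C = (complex.Re v / a) +i* (complex.Im v / a).
  case: v {hr hi} => x y; rewrite -fmorphV/=.
  by apply/eqP; rewrite eq_complex /= !mulr0 subr0 add0r !eqxx.
by split=> /=; [exact: (has_rint_affine b a0 hr)|exact: (has_rint_affine b a0 hi)].
Qed.

Lemma mpreserving_shift (b : R) : mpreserving leb leb (fun x : RR => x + b : RR).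
Proof.
have mphi : measurable_fun setT (fun x : RR => x + b) by exact: measurable_funD.
split; first exact: mphi.
move=> A mA; apply: etrans (@lebesgue_measure_affine 1 b A ltr01 mA) _; rewrite mul1e.
by congr (leb _); apply/seteqP; split=> x /=; rewrite mulr1.
Qed.

Lemma mpreserving_shift_tuple n (c : 'I_n -> R) :
  mpreserving (power_measure leb n) (power_measure leb n)
    (fun t : n.-tuple RR =>
       [tuple (tnth t i + c i : measurableTypeR R) | i < n]).
Proof.
elim: n c => [|n ih] c.
  by apply: eq_mpreserving (mpreserving_id _) => t; apply: eq_from_tnth => -[].
apply: eq_mpreserving (mpreserving_comp (mpreserving_uncons leb n)
  (mpreserving_comp (mpreserving_prod (mpreserving_shift (c ord0))
     (ih (fun i => c (lift ord0 i)))) (mpreserving_cons leb n))).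
move=> t; apply: eq_from_tnth => i; rewrite tnth_mktuple.
case: (unliftP ord0 i) => [j ->|->]; rewrite /cons_pair /=.
  by rewrite tnthS tnth_mktuple -tnth_lift0.
by rewrite tnth0.
Qed.

Lemma has_rint_gauss (m c : R) : 0 < m ->
  has_rint leb (fun x => expR (- (m * (x + c) ^+ 2))) (Num.sqrt (pi / m)).
Proof.
move=> m0; have sm0 : 0 < Num.sqrt m by rewrite sqrtr_gt0.
have h : has_rint leb (@gauss_fun R) (Num.sqrt pi).
  by split; [exact: integrableT_gauss|exact: integralT_gauss].
have := has_rint_affine (Num.sqrt m * c) sm0 h.
rewrite sqrtrM ?pi_ge0// sqrtrV ?(ltW m0)//; congr (has_rint _ _ _).
apply/funext => x; rewrite /gauss_fun; congr (expR (- _)).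
by rewrite mulrC -mulrDr exprMn sqr_sqrtr// ltW.
Qed.

End affine.

(** * Positive definite matrices *)

(** The rows [v'] and [b'] stand for the conjugate transposes of [v] and [b]; keeping them
    independent makes this an identity over any field, free of conjugation. *)
Lemma complete_square (F : fieldType) n (a : F) (W : 'M[F]_n) (v b : 'cV[F]_n)
    (v' b' : 'rV[F]_n) : a != 0 -> W \in unitmx ->
  (v' + a^-1 *: (b' *m W)) *m (a *: invmx W) *m (v + a^-1 *: (W *m b)) =
  a *: (v' *m invmx W *m v) + b' *m v + v' *m b + a^-1 *: (b' *m W *m b).
Proof.
move=> a0 uW; rewrite !mulmxDl !mulmxDr !addrA.
rewrite -!(scalemxAl, scalemxAr) !scalerA !mulmxA.
rewrite !(mulmxK uW) (mulmxKV uW) !(mulfV a0) !(mulVf a0) !scale1r mul1r.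
by rewrite [X in X + _]addrAC.
Qed.

(** Passing from [D] to its Schur complement costs exactly the term left over when the square is
    completed. *)
Lemma trace_rank1_update (F : fieldType) n (a : F) (D W : 'M[F]_n) (b : 'cV[F]_n)
    (b' : 'rV[F]_n) :
  \tr ((D - a *: (b *m b')) *m W) = \tr (D *m W) - a * (b' *m W *m b) 0 0.
Proof.
rewrite mulmxBl -scalemxAl raddfB /= mxtraceZ -[b *m b' *m W]mulmxA.
by rewrite [\tr (b *m _)]mxtrace_mulC trace_mx11.
Qed.

Section hermitian_matrices.
Context {R : realType}.
Local Notation C := R[i].

Lemma ctrM m n p (A : 'M[C]_(m, n)) (B : 'M[C]_(n, p)) :
  (A *m B)^t* = B^t* *m A^t*.
Proof. by rewrite trmx_mul map_mxM. Qed.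

Lemma ctrD m n (A B : 'M[C]_(m, n)) : (A + B)^t* = A^t* + B^t*.
Proof. by rewrite linearD /= map_mxD. Qed.

Lemma ctrZ m n (a : C) (A : 'M[C]_(m, n)) : (a *: A)^t* = Num.conj a *: A^t*.
Proof. by rewrite linearZ /= map_mxZ. Qed.

Lemma conjC_real (r : R) : Num.conj (r%:C : C) = r%:C.
Proof. exact: conjc_real. Qed.

Lemma ctr_block m1 m2 n1 n2 (A : 'M[C]_(m1, n1)) (B : 'M[C]_(m1, n2))
    (D : 'M[C]_(m2, n1)) (E : 'M[C]_(m2, n2)) :
  (block_mx A B D E)^t* = block_mx (A^t*) (D^t*) (B^t*) (E^t*).
Proof. by rewrite tr_block_mx map_block_mx. Qed.

Lemma ctr_col m1 m2 n (A : 'M[C]_(m1, n)) (B : 'M[C]_(m2, n)) :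
  (col_mx A B)^t* = row_mx (A^t*) (B^t*).
Proof. by rewrite tr_col_mx map_row_mx. Qed.

Lemma ctr1 n : (1%:M : 'M[C]_n)^t* = 1%:M.
Proof. by rewrite trmx1 map_mx1. Qed.

Lemma ctr0 m n : (0 : 'M[C]_(m, n))^t* = 0.
Proof. by rewrite trmx0 map_mx0. Qed.

Lemma hermsymmxE n (A : 'M[C]_n) : (A \is hermsymmx) = (A^t* == A).
Proof. by rewrite qualifE /= expr0 scale1r eq_sym. Qed.

Lemma posdefP n (A : 'M[C]_n) : posdefmx A <->
  A^t* = A /\ forall v : 'cV[C]_n, v != 0 -> 0 < (v^t* *m A *m v) 0 0.
Proof. by rewrite /posdefmx hermsymmxE; split=> -[/eqP]. Qed.

Lemma posdef1 n : posdefmx (1%:M : 'M[C]_n).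
Proof.
apply/posdefP; split=> [|v v0]; first exact: ctr1.
rewrite mulmx1 mxE.
have [i vi0] : exists i, v i 0 != 0.
  apply/existsP; apply: contraNT v0; rewrite negb_exists => /forallP h.
  by apply/eqP/colP => i; move: (h i); rewrite negbK mxE => /eqP.
rewrite (bigD1 i) //= ltr_wpDr//.
  by apply: sumr_ge0 => j _; rewrite !mxE mulrC mul_conjC_ge0.
by rewrite !mxE mulrC mul_conjC_gt0.
Qed.

Lemma posdefD n (A B : 'M[C]_n) : posdefmx A -> posdefmx B -> posdefmx (A + B).
Proof.
move=> /posdefP[hA pA] /posdefP[hB pB]; apply/posdefP; split.
  by rewrite ctrD hA hB.
by move=> v v0; rewrite mulmxDr mulmxDl mxE addr_gt0 ?pA ?pB.
Qed.

Lemma posdef_sum n k (X : 'I_k -> 'M[C]_n) (A : 'M[C]_n) : posdefmx A ->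
  (forall j, posdefmx (X j)) -> posdefmx (A + \sum_j X j).
Proof.
move=> pA pX; elim: k X pX => [|k ih] X pX; first by rewrite big_ord0 addr0.
rewrite big_ord_recr addrA; apply: posdefD; last exact: pX.
by apply: (ih (fun j => X (widen_ord (leqnSn k) j))) => j; exact: pX.
Qed.

Lemma posdefZ n (a : R) (A : 'M[C]_n) : 0 < a -> posdefmx A -> posdefmx (a%:C *: A).
Proof.
move=> a0 /posdefP[hA pA]; apply/posdefP; split.
  by rewrite ctrZ hA conjC_real.
by move=> v v0; rewrite -scalemxAr -scalemxAl mxE mulr_gt0 ?pA ?ltcR.
Qed.

Lemma posdef_unit n (A : 'M[C]_n) : posdefmx A -> A \in unitmx.
Proof.
move=> /posdefP[hA pA]; rewrite -row_free_unit -kermx_eq0; apply/eqP/row_matrixP => i.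
rewrite row0; apply/eqP; apply: contraT => ri0.
have /(pA ((row i (kermx A))^t*)) : (row i (kermx A))^t* != 0.
  apply: contraNneq ri0 => /(congr1 (fun M => M^t*)).
  by rewrite trmxCK ctr0 => ->.
by rewrite trmxCK -row_mul mulmx_ker row0 mul0mx mxE ltxx.
Qed.

Lemma posdef_congrW n (P A : 'M[C]_n) : P \in unitmx -> posdefmx A ->
  posdefmx (P^t* *m A *m P).
Proof.
move=> uP /posdefP[hA pA]; apply/posdefP; split.
  by rewrite !ctrM trmxCK hA mulmxA.
move=> v v0; have := pA (P *m v); rewrite ctrM !mulmxA; apply.
by apply: contraNneq v0 => /(congr1 (mulmx (invmx P))); rewrite mulKmx// mulmx0 => ->.
Qed.

Lemma posdef_congr n (A P : 'M[C]_n) : P \in unitmx ->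
  posdefmx (P^t* *m A *m P) <-> posdefmx A.
Proof.
move=> uP; split; last exact: posdef_congrW.
have uV : invmx P \in unitmx by rewrite unitmx_inv.
have E : (invmx P)^t* *m (P^t* *m A *m P) *m invmx P = A.
  by rewrite !mulmxA -ctrM (mulmxV uP) ctr1 mul1mx -mulmxA (mulmxV uP) mulmx1.
by move=> /(posdef_congrW uV); rewrite E.
Qed.

Lemma ctr_invmx n (A : 'M[C]_n) : A^t* = A -> (invmx A)^t* = invmx A.
Proof.
by move=> hA; rewrite trmx_inv map_invmx hA.
Qed.

Lemma posdef_inv n (A : 'M[C]_n) : posdefmx A -> posdefmx (invmx A).
Proof.
move=> pA; have uA := posdef_unit pA; have [hA _] := (posdefP A).1 pA.
have uV : invmx A \in unitmx by rewrite unitmx_inv.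
by have := posdef_congrW uV pA; rewrite (ctr_invmx hA) (mulVmx uA) mul1mx.
Qed.

Definition cdiag n (s : R) (A : 'M[C]_n) : 'M[C]_(1 + n) := block_mx (s%:C)%:M 0 0 A.

Lemma posdef_cdiag n (s : R) (A : 'M[C]_n) :
  posdefmx (cdiag s A) <-> 0 < s /\ posdefmx A.
Proof.
have qf (x : 'M[C]_1) (v : 'cV[C]_n) : ((col_mx x v)^t* *m cdiag s A *m col_mx x v) 0 0 =
    s%:C * `|x 0 0| ^+ 2 + (v^t* *m A *m v) 0 0.
  rewrite ctr_col mul_row_block mul_row_col !mulmx0 addr0 add0r mxE; congr (_ + _).
  by rewrite mul_mx_scalar -scalemxAl mxE; congr (_ * _); rewrite mxE big_ord1 !mxE normCK mulrC.
split.
  move=> /posdefP[hA pA]; split.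
    have /pA : col_mx (1%:M : 'M[C]_1) (0 : 'cV[C]_n) != 0.
      apply/eqP => /(congr1 usubmx); rewrite col_mxKu linear0 => /matrixP/(_ 0 0).
      by rewrite !mxE => /eqP; rewrite oner_eq0.
    by rewrite qf ctr0 mul0mx mul0mx !mxE normr1 expr1n mulr1 addr0 ltcR.
  apply/posdefP; split.
    move: hA; rewrite /cdiag ctr_block => /eq_block_mx[_ _ _ ->] //.
  move=> v v0; have /pA : col_mx (0 : 'M[C]_1) v != 0.
    by apply: contraNneq v0 => /(congr1 dsubmx); rewrite col_mxKd linear0 => ->.
  by rewrite qf mxE normr0 expr0n /= mulr0 add0r.
move=> [s0 /posdefP[hA pA]]; apply/posdefP; split.
  rewrite /cdiag ctr_block hA !ctr0; congr block_mx.
  by rewrite tr_scalar_mx map_scalar_mx; congr (_%:M); exact: conjC_real.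
move=> v; rewrite -[v]vsubmxK; set x := usubmx v; set w := dsubmx v => xw0.
have pw : 0 <= (w^t* *m A *m w) 0 0.
  by have [->|/pA/ltW//] := eqVneq w 0; rewrite mulmx0 mxE.
have s0C : 0 < s%:C :> C by rewrite ltcR.
rewrite qf; have [w0|w0] := eqVneq w 0; last first.
  by rewrite ltr_wpDl ?pA// mulr_ge0 ?(ltW s0C)// exprn_ge0.
rewrite ltr_wpDr// mulr_gt0// exprn_gt0// normr_gt0.
apply: contraNneq xw0 => x0; rewrite w0.
by rewrite [x]mx11_scalar x0 -scalemx1 scale0r col_mx0.
Qed.

Lemma det_cdiag n (s : R) (A : 'M[C]_n) : \det (cdiag s A) = s%:C * \det A.
Proof. by rewrite /cdiag det_ublock det_scalar1. Qed.

(** The shears are the unipotent factors of a block LDL decomposition: congruence by them turns a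
    bordered matrix into a [cdiag], preserving determinant and positivity. *)
Definition ushear n (u : 'cV[C]_n) : 'M[C]_(1 + n) := block_mx 1%:M (u^t*) 0 1%:M.
Definition lshear n (u : 'cV[C]_n) : 'M[C]_(1 + n) := block_mx 1%:M 0 u 1%:M.

Lemma det_ushear n (u : 'cV[C]_n) : \det (ushear u) = 1.
Proof. by rewrite /ushear det_ublock !det1 mulr1. Qed.

Lemma det_lshear n (u : 'cV[C]_n) : \det (lshear u) = 1.
Proof. by rewrite /lshear det_lblock !det1 mulr1. Qed.

Lemma ctr_lshear n (u : 'cV[C]_n) : (lshear u)^t* = ushear u.
Proof. by rewrite ctr_block !ctr1 ctr0. Qed.

Lemma ctr_ushear n (u : 'cV[C]_n) : (ushear u)^t* = lshear u.
Proof. by rewrite -ctr_lshear trmxCK. Qed.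

Lemma unit_lshear n (u : 'cV[C]_n) : lshear u \in unitmx.
Proof. by rewrite unitmxE det_lshear unitr1. Qed.

Lemma unit_ushear n (u : 'cV[C]_n) : ushear u \in unitmx.
Proof. by rewrite unitmxE det_ushear unitr1. Qed.

Definition hblock n (y : R) (v : 'cV[C]_n) (W : 'M[C]_n) : 'M[C]_(1 + n) :=
  block_mx (y%:C)%:M (v^t*) v W.

(** The real part only changes the type when [M] is Hermitian, by [qformE]. *)
Definition qform n (M : 'M[C]_n) (v : 'cV[C]_n) : R := complex.Re ((v^t* *m M *m v) 0 0).

Lemma qformE n (M : 'M[C]_n) v : M^t* = M ->
  v^t* *m M *m v = ((qform M v)%:C)%:M.
Proof.
move=> hM; rewrite [LHS]mx11_scalar; congr (_%:M); rewrite /qform.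
apply/esym/RRe_real; rewrite CrealE; apply/eqP.
transitivity (((v^t* *m M *m v)^t*) 0 0); first by rewrite !mxE.
by rewrite !ctrM trmxCK hM mulmxA.
Qed.

Lemma hermitian_hblock n (A : 'M[C]_(1 + n)) : A^t* = A ->
  A = hblock (complex.Re (A 0 0)) (dlsubmx A) (drsubmx A) /\
  (drsubmx A)^t* = drsubmx A.
Proof.
move=> hA; have := hA; rewrite -{1 2}[A]submxK ctr_block => /eq_block_mx[h1 h2 h3 h4].
split=> //; rewrite -{1}[A]submxK /hblock; congr block_mx; last by rewrite h2.
rewrite [ulsubmx A]mx11_scalar; congr (_%:M); rewrite !mxE !lshift0.
apply/esym/RRe_real; rewrite CrealE; apply/eqP.
by move/matrixP: hA => /(_ 0 0); rewrite !mxE.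
Qed.

(** Elimination through the lower block, suited to the variable of integration, whose corner is
    integrated out at fixed [W]. The companion [hblock_ushear] eliminates through the corner and is
    applied to the parameter matrix and to Gaussian forms. *)
Lemma hblock_lshear n (s : R) (u : 'cV[C]_n) (W : 'M[C]_n) : W^t* = W ->
  (lshear u)^t* *m cdiag s W *m lshear u = hblock (s + qform W u) (W *m u) W.
Proof.
move=> hW; rewrite ctr_lshear /ushear /cdiag /lshear /hblock !mulmx_block.
rewrite !(mulmx0, mul0mx, mul1mx, mulmx1, addr0, add0r) ctrM hW qformE//.
by rewrite rmorphD raddfD /=.
Qed.

Lemma hblock_ushear n (a : R) (b : 'cV[C]_n) (D : 'M[C]_n) : a != 0 ->
  (ushear (a^-1%:C *: b))^t* *m cdiag a (D - a^-1%:C *: (b *m b^t*)) *m ushear (a^-1%:C *: b)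
  = hblock a b D.
Proof.
move=> a0; have a0C : a%:C != 0 :> C by rewrite (inj_eq (@complexI R) a 0).
have aV : a^-1%:C = (a%:C)^-1 :> C by rewrite fmorphV.
rewrite ctr_ushear /ushear /cdiag /lshear /hblock !mulmx_block.
rewrite !(mulmx0, mul0mx, mul1mx, mulmx1, addr0, add0r) ctrZ.
rewrite conjC_real.
rewrite mul_mx_scalar scalerA mul_scalar_mx scalerA aV mulfV// !scale1r.
congr block_mx.
by rewrite -scalemxAr addrC subrK.
Qed.

Lemma posdef_hblock_corner n (y : R) (v : 'cV[C]_n) (W : 'M[C]_n) :
  posdefmx (hblock y v W) -> 0 < y /\ posdefmx W.
Proof.
move=> /posdefP[hA pA]; split.
  have /pA : col_mx (1%:M : 'M[C]_1) (0 : 'cV[C]_n) != 0.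
    apply/eqP => /(congr1 usubmx); rewrite col_mxKu linear0 => /matrixP/(_ 0 0).
    by rewrite !mxE => /eqP; rewrite oner_eq0.
  rewrite ctr_col /hblock mul_row_block mul_row_col !mulmx0 ctr0 !mul0mx addr0 addr0 ctr1.
  by rewrite mul1mx mulmx1 !mxE ltcR.
apply/posdefP; split; first by move: hA; rewrite ctr_block => /eq_block_mx[_ _ _ ->].
move=> w w0; have /pA : col_mx (0 : 'M[C]_1) w != 0.
  by apply: contraNneq w0 => /(congr1 dsubmx); rewrite col_mxKd linear0 => ->.
by rewrite ctr_col /hblock mul_row_block mul_row_col !mulmx0 ctr0 !mul0mx !add0r.
Qed.

(** The corner is written with its shift because [s] is the variable that remains after translating
    the innermost integral. *)
Lemma posdef_hblock_schur n (s : R) (v : 'cV[C]_n) (W : 'M[C]_n) : posdefmx W ->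
  (posdefmx (hblock (s + qform (invmx W) v) v W) <-> 0 < s) /\
  \det (hblock (s + qform (invmx W) v) v W) = s%:C * \det W.
Proof.
move=> pW; have uW := posdef_unit pW; have [hW _] := (posdefP W).1 pW.
have E : hblock (s + qform (invmx W) v) v W =
    (lshear (invmx W *m v))^t* *m cdiag s W *m lshear (invmx W *m v).
  rewrite hblock_lshear// mulKVmx//; congr hblock; congr (_ + complex.Re (fun_of_matrix _ _ _)).
  by rewrite ctrM ctr_invmx// !mulmxA mulmxKV.
rewrite E; split.
  by rewrite posdef_congr ?unit_lshear// posdef_cdiag; split=> [[]|].
by rewrite !det_mulmx ctr_lshear det_ushear det_lshear mulr1 mul1r det_cdiag.
Qed.

Lemma posdef_hblock_compl n (a : R) (b : 'cV[C]_n) (D : 'M[C]_n) :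
  posdefmx (hblock a b D) -> [/\ 0 < a, posdefmx (D - a^-1%:C *: (b *m b^t*)) &
    \det (hblock a b D) = a%:C * \det (D - a^-1%:C *: (b *m b^t*))].
Proof.
move=> pA; have [a0 _] := posdef_hblock_corner pA.
move: pA; rewrite -(@hblock_ushear _ a b D) ?gt_eqF// posdef_congr ?unit_ushear//.
move=> /posdef_cdiag[_ pS]; split=> //.
by rewrite !det_mulmx ctr_ushear det_ushear det_lshear mulr1 mul1r det_cdiag.
Qed.

Lemma posdef_det_gt0 n (A : 'M[C]_n) : posdefmx A -> 0 < \det A.
Proof.
elim: n A => [|n ih] A pA; first by rewrite det_mx00.
have [hA _] := (posdefP A).1 pA; have [E _] := @hermitian_hblock n A hA.
move: pA; rewrite E => /posdef_hblock_compl[a0 /ih d0 ->].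
by rewrite mulr_gt0// ltcR.
Qed.

Lemma absdet_posdef n (A : 'M[C]_n) : posdefmx A ->
  0 < absdet A /\ \det A = (absdet A)%:C.
Proof.
move=> /posdef_det_gt0 d0; have E : \det A = (absdet A)%:C.
  by rewrite /absdet (ger0_norm (ltW d0)); apply/esym/RRe_real/gtr0_real.
by split=> //; rewrite -ltcR -E.
Qed.

Lemma absdetM_real n m (A : 'M[C]_n) (B : 'M[C]_m) (s : R) : 0 <= s ->
  \det A = s%:C * \det B -> absdet A = s * absdet B.
Proof.
move=> s0 E; apply: complexI; rewrite rmorphM /= /absdet -!/(Renorm _) !RenormE E normrM.
by rewrite ger0_norm// lecR.
Qed.

Lemma qform_cdiag n (s : R) (M : 'M[C]_n) (x : 'M[C]_1) (v : 'cV[C]_n) :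
  qform (cdiag s M) (col_mx x v) =
  s * (complex.Re (x 0 0) ^+ 2 + complex.Im (x 0 0) ^+ 2) + qform M v.
Proof.
rewrite /qform ctr_col mul_row_block mul_row_col !mulmx0 addr0 add0r mxE [LHS]raddfD; congr (_ + _).
rewrite mul_mx_scalar -scalemxAl mxE mxE big_ord1 [(x^t*) 0 0]mxE [x^T 0 0]mxE.
by rewrite mulrC [_ * x 0 0]mulrC -normCK -add_Re2_Im2 -rmorphM/= mulrC.
Qed.

(** Completes the square in the first complex coordinate only: its real and imaginary parts
    decouple, and the other coordinates see the Schur complement. *)
Lemma qform_hblock n (m : R) (u : 'cV[C]_n) (N : 'M[C]_n) (x : 'M[C]_1) (v : 'cV[C]_n) :
  m != 0 -> let z := ((m^-1%:C *: u)^t* *m v) 0 0 in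
  qform (hblock m u N) (col_mx x v) =
  m * ((complex.Re (x 0 0) + complex.Re z) ^+ 2 +
       (complex.Im (x 0 0) + complex.Im z) ^+ 2) +
  qform (N - m^-1%:C *: (u *m u^t*)) v.
Proof.
move=> m0 z; rewrite -(hblock_ushear u N m0) /qform.
have E (P M : 'M[C]_(1 + n)) (w : 'cV[C]_(1 + n)) :
    w^t* *m (P^t* *m M *m P) *m w = (P *m w)^t* *m M *m (P *m w).
  by rewrite ctrM !mulmxA.
rewrite E {1 2}/ushear mul_block_col !mul1mx mul0mx add0r.
set y := x + _; rewrite -[LHS]/(qform (cdiag m _) (col_mx y v)) qform_cdiag.
by rewrite mxE [complex.Re (_ + _)]raddfD [complex.Im (_ + _)]raddfD.
Qed.

(** The exponent separates into one term for each of the three integrations; the contributions of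
    b^* W b / a from [complete_square] and [trace_rank1_update] cancel. *)
Lemma Re_trace_hblock n (a : R) (b : 'cV[C]_n) (D : 'M[C]_n) (z : R) (v : 'cV[C]_n)
    (W : 'M[C]_n) : a != 0 -> W \in unitmx -> W^t* = W ->
  complex.Re (\tr (hblock a b D *m hblock (z + qform (invmx W) v) v W)) =
  a * z + qform (a%:C *: invmx W) (v + a^-1%:C *: (W *m b)) +
  complex.Re (\tr ((D - a^-1%:C *: (b *m b^t*)) *m W)).
Proof.
move=> a0 uW hW.
have a0C : a%:C != 0 :> C by rewrite (inj_eq (@complexI R) a 0).
have aV : a^-1%:C = (a%:C)^-1 :> C by rewrite fmorphV.
pose q := v^t* *m invmx W *m v.
have qE : q 0 0 = (qform (invmx W) v)%:C.
  by rewrite /q qformE ?ctr_invmx// mxE mulr1n.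
have LE : \tr (hblock a b D *m hblock (z + qform (invmx W) v) v W) =
    a%:C * z%:C + (a%:C * q 0 0 + (b^t* *m v) 0 0 + (v^t* *m b) 0 0) + \tr (D *m W).
  rewrite /hblock mulmx_block mxtrace_block !mxtraceD -scalar_mxM mxtrace_scalar mulr1n.
  by rewrite (mxtrace_mulC b) !trace_mx11 qE rmorphD mulrDr !addrA.
have ME : (v + a^-1%:C *: (W *m b))^t* *m (a%:C *: invmx W) *m (v + a^-1%:C *: (W *m b)) =
    a%:C *: q + b^t* *m v + v^t* *m b + a^-1%:C *: (b^t* *m W *m b).
  by rewrite ctrD ctrZ ctrM hW conjC_real aV complete_square.
have SE : \tr ((D - a^-1%:C *: (b *m b^t*)) *m W) =
    \tr (D *m W) - a^-1%:C * (b^t* *m W *m b) 0 0.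
  exact: trace_rank1_update.
rewrite LE /qform ME SE -(_ : complex.Re (a%:C * z%:C) = a * z); last first.
  by rewrite /= mulr0 subr0.
rewrite -!raddfD; congr complex.Re; rewrite !mxE.
ring.
Qed.

End hermitian_matrices.

(** * Gaussian integrals *)

Section gaussian.
Context {R : realType}.
Local Notation C := R[i].
Local Notation leb := (@lebesgue_measure R).
Local Notation RR := (measurableTypeR R).

Section matrix_measurability.
Context d (T : measurableType d).

Definition mxmeasurable m n (F : T -> 'M[C]_(m, n)) := forall i j, cmeasurable (fun t => F t i j).

Lemma mxmeasurable_cst m n (A : 'M[C]_(m, n)) : mxmeasurable (fun=> A).
Proof. by move=> i j; exact: cmeasurable_cst. Qed.

Lemma mxmeasurableD m n (F G : T -> 'M[C]_(m, n)) : mxmeasurable F -> mxmeasurable G ->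
  mxmeasurable (fun t => F t + G t).
Proof. by move=> mF mG i j; under eq_fun do rewrite mxE; exact: cmeasurableD. Qed.

Lemma mxmeasurableM m n p (F : T -> 'M[C]_(m, n)) (G : T -> 'M[C]_(n, p)) :
  mxmeasurable F -> mxmeasurable G -> mxmeasurable (fun t => F t *m G t).
Proof.
move=> mF mG i j; under eq_fun do rewrite mxE.
by apply: cmeasurable_sum => k; exact: cmeasurableM.
Qed.

Lemma mxmeasurable_ctr m n (F : T -> 'M[C]_(m, n)) :
  mxmeasurable F -> mxmeasurable (fun t => (F t)^t*).
Proof.
move=> mF i j; have [mr mi] := mF j i.
have E t : ((F t)^t*) i j = complex.Re (F t j i) -i* complex.Im (F t j i).
  by rewrite !mxE; case: (F t j i).
split.
  by rewrite (_ : (fun t => _) = (fun t => complex.Re (F t j i)))//; apply/funext => t; rewrite E.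
rewrite (_ : (fun t => _) = (fun t => - complex.Im (F t j i))); last first.
  by apply/funext => t; rewrite E.
exact: measurable_funN.
Qed.

Lemma cmeasurable_det n (F : T -> 'M[C]_n) : mxmeasurable F ->
  cmeasurable (fun t => \det (F t)).
Proof.
move=> mF; apply: cmeasurable_sum => s; apply: cmeasurableM.
  exact: cmeasurable_cst.
by apply: cmeasurable_prod => i; exact: mF.
Qed.

Lemma cmeasurable_trace n (F : T -> 'M[C]_n) : mxmeasurable F ->
  cmeasurable (fun t => \tr (F t)).
Proof. by move=> mF; apply: cmeasurable_sum => i; exact: mF. Qed.

Lemma measurable_absdet n (F : T -> 'M[C]_n) : mxmeasurable F ->
  measurable_fun setT (fun t => absdet (F t)).
Proof. by move=> /cmeasurable_det/measurable_Renorm. Qed.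

End matrix_measurability.

(** The minus sign is that of [hermmx]: the stored coordinates x + iy belong to the first row, and
    this is the first column. *)
Definition cvec n (z : n.-tuple RR * n.-tuple RR) : 'cV[C]_n :=
  \col_i (tnth z.1 i -i* tnth z.2 i).

Lemma mxmeasurable_cvec n : mxmeasurable (@cvec n).
Proof.
move=> i j; under eq_fun do rewrite mxE; split => /=.
  exact: (measurableT_comp (@measurable_tnth _ RR n i) measurable_fst).
apply: measurable_funN.
exact: (measurableT_comp (@measurable_tnth _ RR n i) measurable_snd).
Qed.

Lemma measurable_qform d (T : measurableType d) n (M : 'M[C]_n) (v : T -> 'cV[C]_n) :
  mxmeasurable v -> measurable_fun setT (fun t => qform M (v t)).
Proof.
move=> mv; have [] // : cmeasurable (fun t => ((v t)^t* *m M *m v t) 0 0).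
apply: mxmeasurableM => //; apply: mxmeasurableM; last exact: mxmeasurable_cst.
exact: mxmeasurable_ctr.
Qed.

Lemma has_rint_dirac d (T : measurableType d) (a : T) (f : T -> R) :
  measurable_fun setT f -> has_rint (\d_a : {measure set T -> \bar R}) f (f a).
Proof.
move=> mf; have mef : measurable_fun setT (EFin \o f) by exact/measurable_EFinP.
split; last first.
  by rewrite (@integral_dirac _ _ _ _ _ measurableT (EFin \o f) mef) diracT mul1e.
apply/integrableP; split; first exact: mef.
have maf : measurable_fun setT (fun x => `|(EFin \o f) x|%E) by exact: measurableT_comp.
by rewrite (@integral_dirac _ _ _ _ _ measurableT _ maf) diracT mul1e /= ltry.
Qed.

Lemma norm_real (r : R) : 0 <= r -> `|r%:C| = r%:C :> C.
Proof. by move=> r0; rewrite ger0_norm// lecR. Qed.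

Lemma norm_expR (r : R) : `|(expR r)%:C| = (expR r)%:C :> C.
Proof. by rewrite norm_real ?expR_ge0. Qed.

Lemma realcM (a b : R) : (a * b)%:C = a%:C * b%:C :> C.
Proof. exact: rmorphM. Qed.

(** The new coordinates head both tuples but form the second factor of the product, so they are
    integrated first. *)
Definition cons_tuples n (z : (n.-tuple RR * n.-tuple RR) * (RR * RR)) :
    n.+1.-tuple RR * n.+1.-tuple RR :=
  (cons_pair (z.2.1, z.1.1), cons_pair (z.2.2, z.1.2)).

Lemma mpreserving_cons_tuples n :
  mpreserving (prodm (prodm (power_measure leb n) (power_measure leb n)) (prodm leb leb))
    (prodm (power_measure leb n.+1) (power_measure leb n.+1)) (@cons_tuples n).
Proof.
apply: eq_mpreserving (mpreserving_comp
  (mpreserving_interchange (power_measure leb n) (power_measure leb n) leb leb)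
  (mpreserving_comp
    (mpreserving_prod (mpreserving_swap (power_measure leb n) leb)
                      (mpreserving_swap (power_measure leb n) leb))
    (mpreserving_prod (mpreserving_cons leb n) (mpreserving_cons leb n)))).
by [].
Qed.

Lemma cvec_cons n (z : (n.-tuple RR * n.-tuple RR) * (RR * RR)) :
  cvec (cons_tuples z) = col_mx (z.2.1 -i* z.2.2)%:M (cvec z.1) :> 'cV_(1 + n).
Proof.
apply/matrixP => i j; rewrite ord1 mxE; case: (split_ordP i) => k ->.
  by rewrite col_mxEu ord1 !mxE lshift0 /= !tnth0.
rewrite col_mxEd !mxE (_ : rshift 1 k = lift ord0 k); last exact: val_inj.
by rewrite /= !tnthS.
Qed.

(** Each complex coordinate gives two real Gaussians of value sqrt(pi / m), hence a factor pi / m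
    without square root; the successive pivots m multiply to the determinant. *)
Lemma has_cint_gaussmx n (M : 'M[C]_n) : posdefmx M ->
  has_cint (prodm (power_measure leb n) (power_measure leb n))
    (fun z => (expR (- qform M (cvec z)))%:C) (pi ^+ n / absdet M)%:C.
Proof.
have mF k (N : 'M[C]_k) : cmeasurable (fun z : k.-tuple RR * k.-tuple RR => (expR (- qform N (cvec z)))%:C).
  apply: cmeasurable_real; apply: measurableT_comp => //; apply: measurable_funN.
  by apply: measurable_qform; exact: mxmeasurable_cvec.
elim: n M => [|n ih] M pM.
  have h1 : has_cint (power_measure leb 0) (fun=> 1) 1.
    by apply/has_cint_real; exact: has_rint_dirac.
  rewrite /absdet det_mx00 normr1 expr0.
  have := has_cint_tensor h1 h1; rewrite mulr1.
  have -> : (1 / complex.Re 1)%:C = 1 :> C by rewrite divr1.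
  apply: eq_has_cint => z; rewrite /qform.
  have -> : cvec z = 0 by apply/matrixP => -[].
  by rewrite mulmx0 mxE oppr0 expR0.
apply: (has_cint_mpreserving (mpreserving_cons_tuples n)); first exact: mF.
have [hM _] := (posdefP M).1 pM; have [EM _] := hermitian_hblock (n := n) hM.
set m := complex.Re (M 0 0) in EM; set u := dlsubmx _ in EM; set N := drsubmx _ in EM.
have pM' := pM; rewrite EM in pM'; have [m0 pS dS] := posdef_hblock_compl pM'.
set S := N - _ in pS dS.
have -> : pi ^+ n.+1 / absdet M = pi ^+ n / absdet S * (pi / m).
  have -> : absdet M = m * absdet S by rewrite EM; apply: absdetM_real => //; exact: ltW.
  have [aS _] := absdet_posdef pS.
  by rewrite exprS; field; rewrite !gt_eqF.
pose c w := (((m^-1%:C *: u)^t*) *m cvec w) 0 0 : C.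
have E w x y : (expR (- qform M (cvec (cons_tuples (w, (x, y))))))%:C =
   (expR (- qform S (cvec w)))%:C * ((expR (- (m * (x + complex.Re (c w)) ^+ 2)))%:C *
     (expR (- (m * (y + - complex.Im (c w)) ^+ 2)))%:C).
  rewrite cvec_cons EM qform_hblock ?gt_eqF//= -/(c w) -/S.
  have -> : ((x -i* y)%:M : 'M[C]_1) 0 0 = x -i* y by rewrite mxE.
  rewrite /= -!rmorphM/= -!expRD.
  congr ((expR _)%:C).
  move: (complex.Re (c w)) (complex.Im (c w)) (qform S _) => r1 r2 q.
  ring.
have inner w : has_cint (prodm leb leb)
    (fun z => (expR (- qform M (cvec (cons_tuples (w, z)))))%:C)
    ((expR (- qform S (cvec w)))%:C * (pi / m)%:C).
  have pm : 0 <= pi / m by rewrite divr_ge0 ?pi_ge0// ltW.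
  have G1 := has_rint_gauss (complex.Re (c w)) m0.
  have G2 := has_rint_gauss (- complex.Im (c w)) m0.
  move: G1 G2 => /has_cint_real G1 /has_cint_real G2.
  have := has_cintZ (expR (- qform S (cvec w)))%:C (has_cint_tensor G1 G2).
  rewrite -rmorphM/= -expr2 sqr_sqrtr//.
  by apply: eq_has_cint => -[x y]; exact: (esym (E w x y)).
have outer : has_cint (prodm (power_measure leb n) (power_measure leb n))
    (fun w => (expR (- qform S (cvec w)))%:C * (pi / m)%:C)
    (pi ^+ n / absdet S * (pi / m))%:C.
  rewrite [X in has_cint _ _ X]realcM; exact: (has_cintZr (pi / m)%:C (ih S pS)).
(* The integrand is real and nonnegative, so it is its own majorant. *)
apply: (has_cint_prod _ _ inner outer inner outer).
  exact: (cmeasurable_comp (mpreserving_cons_tuples n).1 (mF _ M)).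
by move=> z; exact: norm_expR.
Qed.

Lemma has_cint_gaussmx_shift n (M : 'M[C]_n) (c : 'cV[C]_n) : posdefmx M ->
  has_cint (prodm (power_measure leb n) (power_measure leb n))
    (fun z => (expR (- qform M (cvec z + c)))%:C) (pi ^+ n / absdet M)%:C.
Proof.
move=> pM.
(* The signs differ because [cvec] forms x - iy: this translation subtracts [c] from the vector. *)
have P := mpreserving_prod (mpreserving_shift_tuple (fun i => - complex.Re (c i 0)))
  (mpreserving_shift_tuple (fun i => complex.Im (c i 0))).
apply: (has_cint_mpreserving P).
  apply: cmeasurable_real; apply: measurableT_comp => //; apply: measurable_funN.
  apply: measurable_qform; apply: mxmeasurableD; first exact: mxmeasurable_cvec.
  exact: mxmeasurable_cst.
apply: eq_has_cint (has_cint_gaussmx pM) => -[x y] /=.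
congr ((expR (- qform M _))%:C); apply/matrixP => i j; rewrite ord1 !mxE/= !tnth_mktuple.
by case: (c i 0) => e f /=; apply/eqP; rewrite eq_complex /= subrK opprD subrK !eqxx.
Qed.

End gaussian.

(** * The Gamma function *)

Section gamma_convergence.
Context {R : realType}.
Local Notation leb := (@lebesgue_measure R).
Local Notation RR := (measurableTypeR R).

Lemma normr_sin_le (x : R) : `|sin x| <= `|x|.
Proof.
wlog x0 : x / 0 <= x => [h|].
  have [/h//|/ltW x0] := leP 0 x.
  by rewrite -normrN -sinN -[leRHS]normrN; apply: h; rewrite oppr_ge0.
have [c _] : exists2 c, c \in `[0, x]%R & sin x - sin 0 = cos c * (x - 0).
  apply: MVT_segment => //; apply: continuous_subspaceT => y; exact: continuous_sin.
rewrite sin0 !subr0 => ->; rewrite normrM -[leRHS]mul1r.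
by apply: ler_wpM2r => //; exact: cos_max.
Qed.

(** From cos(2u) = 1 - 2 sin(u)^2 with u = x / 2, and [normr_sin_le]. *)
Lemma cos_ge_quad (x : R) : 1 - x ^+ 2 / 2 <= cos x.
Proof.
have -> : x = (x / 2) *+ 2 by rewrite -mulr_natr divfK// pnatr_eq0.
rewrite cos_mulr2n cos2sin2; set u := x / 2.
have : sin u ^+ 2 <= u ^+ 2.
  rewrite -(ger0_norm (sqr_ge0 (sin u))) -(ger0_norm (sqr_ge0 u)) !normrX.
  by rewrite ler_sqr ?nnegrE ?normr_ge0// normr_sin_le.
lra.
Qed.

Lemma measurable_indic_itv (i : interval R) : measurable_fun setT (\1_([set` i]) : RR -> R).
Proof. by apply: measurable_indic; exact: measurable_itv. Qed.

Lemma measurable_expR_ln (c : R) : measurable_fun setT (fun t : RR => expR (c * ln t)).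
Proof.
by apply: measurableT_comp => //; apply: measurable_funM.
Qed.

(** On [1/(n+1), 1] the antiderivative t^x / x bounds the integral by 1/x, uniformly in n; monotone
    convergence extends the bound to []0, 1]]. *)
Lemma has_rint_pow01 (x : R) : 0 < x ->
  exists r, has_rint leb (fun t : RR => \1_`]0, 1] t * expR ((x - 1) * ln t)) r.
Proof.
move=> x0; pose f (t : RR) : R := \1_`]0, 1] t * expR ((x - 1) * ln t).
have mf : measurable_fun setT f.
  by apply: measurable_funM; [exact: measurable_indic_itv|exact: measurable_expR_ln].
have f0 t : 0 <= f t by rewrite mulr_ge0 ?expR_ge0.
pose F n := [set` `[(n.+1%:R^-1 : R), 1]].
have FE : \bigcup_n F n = `]0, 1]%classic.
  rewrite itv_open_bnd_bigcup; apply/seteqP; split.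
  - move=> t [n _]; rewrite /F /= in_itv/= => /andP[nt t1].
    by exists n => //=; rewrite in_itv/= add0r nt.
  - by move=> t [n _ /=]; rewrite in_itv/= add0r => nt; exists n.
have Fle n : (\int[leb]_(t in F n) (f t)%:E <= (x^-1)%:E)%E.
  have n1 : (n.+1%:R^-1 : R) <= 1 by rewrite invf_le1// ler1n.
  have n0 : 0 < (n.+1%:R^-1 : R) by rewrite invr_gt0.
  pose g (t : R) := t `^ (x - 1).
  have -> : (\int[leb]_(t in F n) (f t)%:E = \int[leb]_(t in F n) (g t)%:E)%E.
    apply: eq_integral => t; rewrite inE /F /= in_itv/= => /andP[nt t1].
    have t0 : 0 < t by exact: lt_le_trans nt.
    by rewrite /f indicE mem_set /= ?in_itv/= ?t0// mul1r /g /powR gt_eqF.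
  (* For n = 0 the interval is a single point, outside the scope of the fundamental theorem of
     calculus. *)
  move: n1; rewrite le_eqVlt => /orP[/eqP n1|n1].
    rewrite /F n1 set_itv1 integral_set1//.
    by rewrite lee_fin invr_ge0 ltW.
  have pos (t : R) : t \in `[n.+1%:R^-1, 1] -> 0 < t.
    by rewrite in_itv/= => /andP[nt _]; exact: lt_le_trans nt.
  have poso (t : R) : t \in `]n.+1%:R^-1, 1[ -> 0 < t.
    by rewrite in_itv/= => /andP[nt _]; exact: lt_trans nt.
  have cpow y : {in `]0, +oo[ , continuous (fun t : R => t `^ y)}.
    move=> t t0; apply: differentiable_continuous; apply/derivable1_diffP.
    exact: derivable_powR.
  have dF : derivable_oo_LRcontinuous (fun t : R => t `^ x / x) n.+1%:R^-1 1.
    split.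
    - move=> t /poso t0; apply: derivableM => //.
      by apply: derivable_powR; rewrite in_itv/= t0.
    - apply: cvg_at_right_filter; apply: cvgM; last exact: cvg_cst.
      by apply: cpow; rewrite in_itv/= n0.
    - apply: cvg_at_left_filter; apply: cvgM; last exact: cvg_cst.
      by apply: cpow; rewrite in_itv/= ltr01.
  rewrite /F (@continuous_FTC2 R g (fun t => t `^ x / x))//.
  - rewrite powR1 mul1r -EFinB lee_fin lerBlDr lerDl.
    by rewrite divr_ge0 ?powR_ge0// ltW.
  - apply: continuous_in_subspaceT => t; rewrite inE/= => /pos t0.
    by apply: cpow; rewrite in_itv/= t0.
  - move=> t /poso t0.
    have it0 : t \in `]0, +oo[ by rewrite in_itv/= t0.
    rewrite derive1Mr; last exact: derivable_powR.
    by rewrite powR_derive1// mulrAC divff ?mul1r// gt_eqF.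
have le_int : (\int[leb]_t (f t)%:E <= (x^-1)%:E)%E.
  have -> : (\int[leb]_t (f t)%:E = \int[leb]_(t in `]0%R, 1%R]) (f t)%:E)%E.
    rewrite [RHS]integral_mkcond; apply: eq_integral => t _.
    rewrite patchE; case: ifPn => // /negP tn.
    by rewrite /f indicE memNset ?mul0r// => /mem_set.
  rewrite -FE.
  have ndF : nondecreasing_seq F.
    move=> m n mn; apply/subsetPset => t; rewrite /F/= !in_itv/= => /andP[mt ->].
    rewrite andbT; apply: le_trans mt.
    by rewrite lef_pV2 ?posrE// ler_nat ltnS.
  have mF i : measurable (F i : set RR) by exact: measurable_itv.
  have meF i : measurable_fun (F i : set RR) (EFin \o f).
    by apply: measurable_funTS; exact/measurable_EFinP.
  have := @ge0_nondecreasing_set_cvg_integral _ RR R F (EFin \o f) leb ndF mF meF.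
  move=> /(_ (fun i t _ => f0 t)) h.
  rewrite -(cvg_lim _ h)//; apply: lime_le; first by apply/cvg_ex; eexists; exact: h.
  by near=> n; exact: Fle.
exists (fine (\int[leb]_t (f t)%:E)); apply: (@ge0_has_rint _ _ _ leb f) => //.
rewrite fineK// ge0_fin_numE ?integral_ge0//; first exact: le_lt_trans le_int (ltry _).
by move=> t _; rewrite lee_fin.
Unshelve. all: by end_near. Qed.

Definition rgkernel (x : R) : RR -> R :=
  fun t => \1_`]0, +oo[ t * (expR ((x - 1) * ln t) * expR (- t)).

Lemma measurable_rgkernel x : measurable_fun setT (rgkernel x).
Proof.
apply: measurable_funM; first exact: measurable_indic_itv.
apply: measurable_funM; first exact: measurable_expR_ln.
by apply: measurableT_comp => //; exact: measurable_funN.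
Qed.

Lemma rgkernel_ge0 x t : 0 <= rgkernel x t.
Proof. by rewrite !mulr_ge0 ?expR_ge0. Qed.

Lemma has_rint_rgkernel (x : R) : 0 < x -> exists r, has_rint leb (rgkernel x) r.
Proof.
move=> x0; have [r hr] := has_rint_pow01 x0.
have h0 : 0 < 2^-1 :> R by [].
have he := has_rint_Rintegral (integrable_exponential_pdf h0).
(* (x - 1) ln t <= t / 2 + K, from ln (t / b) <= t / b - 1 with b = 2 (x + 1) *)
pose b := 2 * (x + 1); pose K := (x + 1) * ln b.
have b0 : 0 < b by rewrite mulr_gt0// addr_gt0.
(* The power bounds the kernel on []0, 1]], the exponential density of rate 1/2 beyond 1; the factor
   2 undoes the normalization of that density. *)
apply: (has_rint_dom (@measurable_rgkernel x) _ (has_rintD hr (has_rintZ (2 * expR K) he))).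
move=> t; rewrite ger0_norm ?rgkernel_ge0// /rgkernel !indicE.
have [t0|t0] := ltP 0 t; last first.
  rewrite memNset ?mul0r; last by rewrite /= in_itv/= andbT; apply/negP; rewrite -leNgt.
  by rewrite addr_ge0 ?mulr_ge0 ?expR_ge0// exponential_pdf_ge0.
rewrite mem_set ?mul1r; last by rewrite /= in_itv/= t0.
rewrite exponential_pdfE ?(ltW t0)//.
have [t1|t1] := leP t 1.
  rewrite mem_set ?mul1r; last by rewrite /= in_itv/= t0 t1.
  rewrite ler_wpDr ?mulr_ge0 ?expR_ge0// -[leRHS]mulr1.
  by rewrite ler_wpM2l ?expR_ge0// -expR0 ler_expR oppr_le0 ltW.
rewrite ler_wpDl ?mulr_ge0 ?expR_ge0//.
have -> : 2 * expR K * (2^-1 * expR (- 2^-1 * t)) = expR (K - 2^-1 * t).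
  by rewrite expRD mulNr; field.
rewrite -expRD ler_expR.
have lt0 : 0 <= ln t by rewrite ln_ge0// ltW.
have lnb : ln t <= t / b + ln b.
  rewrite -lerBlDr -ln_div ?posrE//; apply: ltW; apply: ln_sublinear.
  by rewrite divr_gt0.
have : (x - 1) * ln t <= (x + 1) * (t / b + ln b).
  apply: (@le_trans _ _ ((x + 1) * ln t)); first by rewrite ler_wpM2r//; lra.
  by rewrite ler_wpM2l//; lra.
rewrite mulrDr -/K.
have -> : (x + 1) * (t / b) = t / 2 by rewrite /b; field; lra.
lra.
Qed.

End gamma_convergence.

(** * Complex powers *)

Section complex_power.
Context {R : realType}.
Local Notation C := R[i].
Implicit Types (r s : R) (z w : C).

Lemma cpowD r z w : cpow r (z + w) = cpow r z * cpow r w.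
Proof.
case: z w => [a b] [c d]; rewrite /cpow/= !mulrDl expRD cosD sinD.
by apply/eqP; rewrite eq_complex /=; apply/andP; split; apply/eqP; ring.
Qed.

Lemma cpow_real r (x : R) : cpow r x%:C = (expR (x * ln r))%:C.
Proof. by rewrite /cpow/= !mul0r cos0 sin0; apply/eqP; rewrite eq_complex /= mulr1 !mul0r !mulr0 subr0 addr0 !eqxx. Qed.

Lemma cpow0 r : cpow r 0 = 1.
Proof. by have := cpow_real r 0; rewrite mul0r expR0. Qed.

Lemma cpowNK r z : cpow r (- z) * cpow r z = 1.
Proof. by rewrite -cpowD addNr cpow0. Qed.

Lemma cpow_neq0 r z : cpow r z != 0.
Proof.
apply/eqP => h; have := cpowNK r z; rewrite h mulr0 => /eqP.
by rewrite eq_sym oner_eq0.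
Qed.

Lemma cpowN r z : cpow r (- z) = (cpow r z)^-1.
Proof. by apply: (mulIf (cpow_neq0 r z)); rewrite cpowNK mulVf ?cpow_neq0. Qed.

Lemma cpow1 r : 0 < r -> cpow r 1 = r%:C.
Proof. by move=> r0; have := cpow_real r 1; rewrite mul1r lnK. Qed.

Lemma cpow_nat r n : 0 < r -> cpow r n%:R = (r ^+ n)%:C.
Proof.
move=> r0; elim: n => [|n ih]; first by rewrite cpow0.
by rewrite -natr1 cpowD ih cpow1// exprSr realcM.
Qed.

Lemma cpowM r s z : 0 < r -> 0 < s -> cpow (r * s) z = cpow r z * cpow s z.
Proof.
move=> r0 s0; case: z => a b; rewrite /cpow/= lnM// !mulrDr expRD cosD sinD.
by apply/eqP; rewrite eq_complex /=; apply/andP; split; apply/eqP; ring.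
Qed.

(** The source of all the majorants: taking the modulus of a kernel amounts to taking real parts of
    its parameters. *)
Lemma norm_cpow r z : `|cpow r z| = cpow r (complex.Re z)%:C.
Proof.
rewrite cpow_real /cpow normrM norm_expR -[RHS]mulr1; congr (_ * _).
by rewrite normc_def /= cos2Dsin2 sqrtr1.
Qed.

Lemma cmeasurable_cpow d (T : measurableType d) (f : T -> R) z :
  measurable_fun setT f -> cmeasurable (fun t => cpow (f t) z).
Proof.
move=> mf; have ml (c : R) : measurable_fun setT (fun t => c * ln (f t)).
  apply: measurable_funM => //; exact: (measurableT_comp (@measurable_ln R) mf).
apply: cmeasurableM.
  by apply: cmeasurable_real; apply: measurableT_comp.
split => /=.
  exact: (measurableT_comp (continuous_measurable_fun (@continuous_cos R)) (ml _)).
exact: (measurableT_comp (continuous_measurable_fun (@continuous_sin R)) (ml _)).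
Qed.

End complex_power.

Section gamma_function.
Context {R : realType}.
Local Notation C := R[i].
Local Notation leb := (@lebesgue_measure R).
Local Notation RR := (measurableTypeR R).
Implicit Types (z : C) (x : R).

(** The rate [a] serves twice: as the corner of the matrix parameter in the induction, and as 1 + h
    in the functional equation. *)
Definition gkernel z (a : R) : RR -> C :=
  fun t => (\1_`]0, +oo[ t)%:C * (cpow t (z - 1) * (expR (- (a * t)))%:C).

Lemma cmeasurable_gkernel z a : cmeasurable (gkernel z a).
Proof.
apply: cmeasurableM.
  by apply: cmeasurable_real; exact: measurable_indic_itv.
apply: cmeasurableM; first exact: (@cmeasurable_cpow R _ RR id).
apply: cmeasurable_real; apply: measurableT_comp => //; apply: measurable_funN.
exact: measurable_funM.
Qed.

Lemma gkernel_real x t : gkernel x%:C 1 t = (rgkernel x t)%:C.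
Proof.
rewrite /gkernel /rgkernel mul1r (_ : x%:C - 1 = (x - 1)%:C); last by rewrite rmorphB.
by rewrite cpow_real -!realcM.
Qed.

Lemma norm_gkernel z a t : `|gkernel z a t| = gkernel (complex.Re z)%:C a t.
Proof.
rewrite /gkernel normrM [X in _ * X]normrM norm_expR norm_cpow norm_real//; congr (_ * (cpow _ _ * _)).
by case: z => b c; rewrite /= rmorphB.
Qed.

Lemma gkernel_le0 z a t : t <= 0 -> gkernel z a t = 0.
Proof.
move=> t0; rewrite /gkernel indicE memNset ?mul0r//=.
by rewrite in_itv/= andbT; apply/negP; rewrite -leNgt.
Qed.

Lemma gkernel_gt0 z a t : 0 < t -> gkernel z a t = cpow t (z - 1) * (expR (- (a * t)))%:C.
Proof.
by move=> t0; rewrite /gkernel indicE mem_set ?mul1r//= in_itv/= t0.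
Qed.

Lemma has_cint_gkernel1 z : 0 < complex.Re z -> has_cint leb (gkernel z 1) (cGamma z).
Proof.
move=> z0; have [r hr] := has_rint_rgkernel z0; have [mr mi] := cmeasurable_gkernel z 1.
have b t : Renorm (gkernel z 1 t) = rgkernel (complex.Re z) t.
  by apply: complexI; rewrite RenormE norm_gkernel gkernel_real.
have [r1 h1] : exists s, has_rint leb (fun t => complex.Re (gkernel z 1 t)) s.
  by apply: has_rint_dom mr _ hr => t; rewrite -b; exact: Renorm_ge_Re.
have [r2 h2] : exists s, has_rint leb (fun t => complex.Im (gkernel z 1 t)) s.
  by apply: has_rint_dom mi _ hr => t; rewrite -b; exact: Renorm_ge_Im.
have h : has_cint leb (gkernel z 1) (r1 +i* r2) by split.
have mD : measurable (`]0, +oo[%classic : set RR) by exact: measurable_itv.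
have [_ vE] := @cintegral_restrict _ _ _ leb _ (fun t => cpow t (z - 1) * (expR (- (1 * t)))%:C) _ mD h.
have -> // : cGamma z = r1 +i* r2.
rewrite -vE /cGamma; congr (cintegral _ _ _); apply/funext => t; by rewrite mul1r.
Qed.

Lemma has_cint_gkernel z a : 0 < complex.Re z -> 0 < a ->
  has_cint leb (gkernel z a) (cpow a (- z) * cGamma z).
Proof.
move=> z0 a0; have := has_cintZ (cpow a (1 - z)) (has_cint_affine 0 a0 (has_cint_gkernel1 z0)).
have -> : cpow a (1 - z) * (cGamma z / a%:C) = cpow a (- z) * cGamma z.
  have ac0 : a%:C != 0 :> C by rewrite (inj_eq (@complexI R) a 0) gt_eqF.
  by rewrite addrC cpowD cpow1//; field.
apply: eq_has_cint => t; rewrite addr0.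
have [t0|t0] := leP t 0.
  by rewrite !gkernel_le0 ?mulr0// pmulr_lle0.
rewrite !gkernel_gt0 ?mulr_gt0// mul1r (mulrC t) cpowM// mulrA mulrA -cpowD.
by rewrite addrA subrK subrr cpow0 mul1r.
Qed.

Lemma cGamma_real x : 0 < x -> cGamma x%:C = (complex.Re (cGamma x%:C))%:C /\
  has_rint leb (rgkernel x) (complex.Re (cGamma x%:C)).
Proof.
move=> x0; have [hr hi] := @has_cint_gkernel1 x%:C x0.
have E t : gkernel x%:C 1 t = (rgkernel x t)%:C by exact: gkernel_real.
split.
  have -> : cGamma x%:C = complex.Re (cGamma x%:C) +i* complex.Im (cGamma x%:C).
    by case: (cGamma _).
  rewrite -(has_rint_unique (has_rint0 leb) (_ : has_rint leb (fun=> 0) (complex.Im (cGamma x%:C))))//.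
  by move: hi; congr (has_rint _ _ _); apply/funext => t; rewrite E.
by move: hr; congr (has_rint _ _ _); apply/funext => t; rewrite E.
Qed.

End gamma_function.

(** * Functional equation and non-vanishing of Gamma *)

Section gamma_nonvanishing.
Context {R : realType}.
Local Notation C := R[i].
Local Notation leb := (@lebesgue_measure R).
Local Notation RR := (measurableTypeR R).
Implicit Types (z : C) (x a h u t : R).

(** The passage to the limit h -> 0 in elementary form. For b > 0, a gap x > a is contradicted at h
    = (x - a) / (2 b). *)
Lemma le_addr_small x a b : (forall h, 0 < h -> x <= a + h * b) -> x <= a.
Proof.
move=> H; rewrite leNgt; apply/negP => ax.
have [b0|b0] := leP b 0.
  by have := H 1 ltr01; rewrite mul1r leNgt => /negP; apply; lra.
have d0 : 0 < (x - a) / (2 * b) by rewrite divr_gt0 ?subr_gt0// mulr_gt0.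
have := H _ d0.
have -> : (x - a) / (2 * b) * b = (x - a) / 2 by field; rewrite gt_eqF.
by lra.
Qed.

(** Take inverses in exp(u) >= 1 + u and use (1 + u)(1 - u + u^2) = 1 + u^3 >= 1. *)
Lemma expRN_le_quad u : 0 <= u -> expR (- u) <= 1 - u + u ^+ 2.
Proof.
move=> u0; rewrite expRN -[leRHS]invrK.
have p0 : 0 < 1 - u + u ^+ 2 by nra.
rewrite lef_pV2 ?posrE ?expR_gt0 ?invr_gt0//.
apply: le_trans (expR_ge1Dx u); rewrite -[leLHS]div1r ler_pdivrMr//.
have : 0 <= u ^+ 3 by rewrite exprn_ge0.
nra.
Qed.

Definition rGamma x := complex.Re (cGamma x%:C : C).

Lemma has_rint_rGamma x : 0 < x -> has_rint leb (rgkernel x) (rGamma x).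
Proof. by move=> /cGamma_real[]. Qed.

Lemma rGamma_ge0 x : 0 < x -> 0 <= rGamma x.
Proof.
move=> /has_rint_rGamma; apply: le_has_rint (has_rint0 leb) => t.
exact: rgkernel_ge0.
Qed.

Lemma rgkernel_gt0E x t : 0 < t -> rgkernel x t = expR ((x - 1) * ln t) * expR (- t).
Proof.
by move=> t0; rewrite /rgkernel indicE mem_set ?mul1r//= in_itv/= t0.
Qed.

Lemma rgkernel_le0E x t : t <= 0 -> rgkernel x t = 0.
Proof.
move=> t0; rewrite /rgkernel indicE memNset ?mul0r//=.
by rewrite in_itv/= andbT; apply/negP; rewrite -leNgt.
Qed.

Lemma rgkernelS x t : rgkernel (x + 1) t = t * rgkernel x t.
Proof.
have [t0|t0] := leP t 0; first by rewrite !rgkernel_le0E// mulr0.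
rewrite !rgkernel_gt0E// addrK mulrA; congr (_ * _).
by rewrite -{2}(lnK (_ : t \is Num.pos)) ?posrE// -expRD; congr expR; ring.
Qed.

(* Letting h tend to 0 in t^(z-1) (exp(-t) - exp(-(1+h)t)) ~ h t^z exp(-t), whose *)
(* integral is (1 - (1+h)^(-z)) Gamma(z), yields the functional equation.        *)
Lemma gkernel_increment z h t : 0 < h ->
  Renorm (h%:C * gkernel (z + 1) 1 t - (gkernel z 1 t - gkernel z (1 + h) t))
  <= h ^+ 2 * rgkernel (complex.Re z + 2) t.
Proof.
move=> h0; rewrite (_ : complex.Re z + 2 = complex.Re z + 1 + 1); last by ring.
have [t0|t0] := leP t 0.
  by rewrite !gkernel_le0// rgkernel_le0E// mulr0 !subr0 mulr0 /Renorm normr0.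
pose g := gkernel z 1 t.
have -> : h%:C * gkernel (z + 1) 1 t - (gkernel z 1 t - gkernel z (1 + h) t) =
    g * (h * t - 1 + expR (- (h * t)))%:C.
  rewrite /g !gkernel_gt0// mul1r (_ : z + 1 - 1 = (z - 1) + 1); last by rewrite addrK subrK.
  have -> : expR (- ((1 + h) * t)) = expR (- t) * expR (- (h * t)).
    by rewrite -expRD; congr expR; ring.
  rewrite cpowD cpow1// realcM rmorphD rmorphB /= realcM rmorph1.
  ring.
have -> : Renorm (g * (h * t - 1 + expR (- (h * t)))%:C) =
    rgkernel (complex.Re z) t * `|h * t - 1 + expR (- (h * t))|.
  apply: complexI; rewrite RenormE normrM norm_gkernel gkernel_real [RHS]realcM; congr (_ * _).
  by rewrite normc_def /= expr0n /= addr0 sqrtr_sqr.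
rewrite !rgkernelS; have := rgkernel_ge0 (complex.Re z) t.
move: (rgkernel _ t) => r r0.
rewrite mulrC (_ : h ^+ 2 * (t * (t * r)) = (h * t) ^+ 2 * r); last by ring.
apply: ler_wpM2r => //.
have ht0 : 0 <= h * t by rewrite mulr_ge0// ltW.
have := expR_ge1Dx (- (h * t)); have := expRN_le_quad ht0.
move: (expR _) => e; rewrite ler_norml => h1 h2; apply/andP; split; nra.
Qed.

Lemma Gamma_increment z h : 0 < complex.Re z -> 0 < h ->
  Renorm (h%:C * cGamma (z + 1) - (1 - cpow (1 + h) (- z)) * cGamma z)
  <= h ^+ 2 * rGamma (complex.Re z + 2).
Proof.
move=> z0 h0; have z1 : 0 < complex.Re (z + 1) by case: (z) z0 => ? ? /= ?; rewrite addr_gt0.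
have z2 : 0 < complex.Re z + 2 by rewrite addr_gt0.
have h1 : 0 < 1 + h by rewrite addr_gt0.
have H1 := has_cintZ h%:C (has_cint_gkernel1 z1).
have H2 := has_cintB (has_cint_gkernel z0 ltr01) (has_cint_gkernel z0 h1).
have -> : (1 - cpow (1 + h) (- z)) * cGamma z =
    cpow 1 (- z) * cGamma z - cpow (1 + h) (- z) * cGamma z.
  rewrite mulrBl; congr (_ * _ - _); rewrite /cpow ln1 !mulr0 expR0 cos0 sin0.
  by rewrite mul1r.
apply: le_has_cint_norm (has_cintB H1 H2) (has_rintZ (h ^+ 2) (has_rint_rGamma z2)).
by move=> t; exact: gkernel_increment.
Qed.

(** When Gamma(z) = 0 the increment estimate reads h |Gamma(z + 1)| <= h^2 Gamma(Re z + 2). For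
    complex z this inheritance of zeros is all that is extracted; the full functional equation is
    derived for real arguments. *)
Lemma cGamma0S z : 0 < complex.Re z -> cGamma z = 0 -> cGamma (z + 1) = 0.
Proof.
move=> z0 Gz; suff : Renorm (cGamma (z + 1)) <= 0.
  by rewrite -lecR RenormE normr_le0 => /eqP.
apply: (@le_addr_small _ _ (rGamma (complex.Re z + 2))) => h h0.
have := Gamma_increment z0 h0; rewrite Gz mulr0 subr0 add0r.
rewrite -lecR RenormE normrM norm_real ?(ltW h0)// -RenormE -realcM lecR.
by rewrite expr2 -mulrA ler_pM2l.
Qed.

Lemma rGamma_increment x h : 0 < x -> 0 < h ->
  `|h * rGamma (x + 1) - (1 - expR (- x * ln (1 + h))) * rGamma x| <= h ^+ 2 * rGamma (x + 2).
Proof.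
move=> x0 h0; have := @Gamma_increment x%:C h x0 h0.
apply: le_trans; rewrite -lecR RenormE.
have [Gx _] := cGamma_real x0; have [Gx1 _] := cGamma_real (addr_gt0 x0 ltr01).
have E1 : x%:C + 1 = (x + 1)%:C :> C by rewrite rmorphD rmorph1.
have E2 : - x%:C = (- x)%:C :> C by rewrite rmorphN.
have E3 (e : R) : 1 - e%:C = (1 - e)%:C :> C by rewrite rmorphB rmorph1.
have E4 (e f : R) : e%:C - f%:C = (e - f)%:C :> C by rewrite rmorphB.
rewrite E1 E2 cpow_real Gx Gx1 E3 -!realcM E4 normc_def /= expr0n /= addr0 sqrtr_sqr.
by rewrite lecR.
Qed.

Lemma ln1p_bounds h : 0 < h -> h - h ^+ 2 <= ln (1 + h) <= h.
Proof.
move=> h0; have h1 : 0 < 1 + h by lra.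
apply/andP; split; last by rewrite le_ln1Dx//; lra.
(* The lower bound is this inequality at 1 / (1 + h), combined with h / (1 + h) >= h - h^2. *)
have : ln (1 + (- (h / (1 + h)))) <= - (h / (1 + h)).
  by apply: le_ln1Dx; rewrite ltrN2 ltr_pdivrMr// mul1r; lra.
rewrite (_ : 1 + (- (h / (1 + h))) = (1 + h)^-1); last by field; rewrite gt_eqF.
rewrite lnV ?posrE// lerN2; apply: le_trans.
rewrite ler_pdivlMr//; have : 0 <= h ^+ 3 by rewrite exprn_ge0// ltW.
by nra.
Qed.

Lemma expRN_ln1p_bounds x h : 0 < x -> 0 < h ->
  1 - x * h <= expR (- x * ln (1 + h)) <= 1 - x * (h - h ^+ 2) + (x * h) ^+ 2.
Proof.
move=> x0 h0; have /andP[l1 l2] := ln1p_bounds h0.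
have l0 : 0 <= ln (1 + h) by rewrite ln_ge0// lerDl ltW.
apply/andP; split.
  by apply: le_trans (expR_ge1Dx _); rewrite mulNr lerD2l lerN2 ler_pM2l.
rewrite mulNr; apply: le_trans (expRN_le_quad _) _; first by rewrite mulr_ge0// ltW.
apply: lerD; first by rewrite lerD2l lerN2 ler_pM2l.
by rewrite ler_sqr ?nnegrE ?mulr_ge0 ?(ltW x0) ?(ltW h0)// ler_pM2l.
Qed.

(** Here and in [increment_lower], [e], [a], [b], [c] stand for (1 + h)^(-x), Gamma(x), Gamma(x +
    1), Gamma(x + 2). *)
Lemma increment_upper (x h e a b c : R) : 0 < h -> 0 <= a -> 1 - x * h <= e ->
  h * b - (1 - e) * a <= h ^+ 2 * c -> b <= x * a + h * c.
Proof.
move=> h0 a0 e1 H; rewrite -(ler_pM2l h0).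
have : (1 - e) * a <= x * h * a by apply: ler_wpM2r => //; lra.
lra.
Qed.

Lemma increment_lower (x h e a b c : R) : 0 < h -> 0 <= a ->
  e <= 1 - x * (h - h ^+ 2) + (x * h) ^+ 2 ->
  - (h ^+ 2 * c) <= h * b - (1 - e) * a ->
  x * a <= b + h * (c + x * a + x ^+ 2 * a).
Proof.
move=> h0 a0 e1 H; rewrite -(ler_pM2l h0).
have : (x * (h - h ^+ 2) - (x * h) ^+ 2) * a <= (1 - e) * a by apply: ler_wpM2r => //; lra.
lra.
Qed.

Lemma rGammaS x : 0 < x -> rGamma (x + 1) = x * rGamma x.
Proof.
move=> x0; have G0 := rGamma_ge0 x0.
apply/eqP; rewrite eq_le; apply/andP; split.
- apply: (@le_addr_small _ _ (rGamma (x + 2))) => h h0.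
  have := rGamma_increment x0 h0; rewrite ler_norml => /andP[_].
  have /andP[e1 _] := expRN_ln1p_bounds x0 h0.
  exact: increment_upper.
- apply: (@le_addr_small _ _ (rGamma (x + 2) + x * rGamma x + x ^+ 2 * rGamma x)) => h h0.
  have := rGamma_increment x0 h0; rewrite ler_norml => /andP[+ _].
  have /andP[_ e1] := expRN_ln1p_bounds x0 h0.
  exact: increment_lower.
Qed.

(** For x >= 1 the kernel is at least exp(-2) on []1, 2]], an interval of length 1. *)
Lemma rGamma_gt0 x : 1 <= x -> 0 < rGamma x.
Proof.
move=> x1; have x0 : 0 < x by exact: lt_le_trans ltr01 x1.
have h : has_rint leb (\1_`]1, 2] : RR -> R) 1.
  apply: ge0_has_rint; [exact: (@measurable_indic_itv R `]1, 2])|by []|].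
  have mI : measurable (`]1, 2]%classic : set RR) by exact: measurable_itv.
  rewrite integral_indic// setIT.
  apply: etrans (@lebesgue_measure_itv R `]1, 2]) _; rewrite /= lte_fin ltr1n.
  by rewrite -EFinB; congr EFin; ring.
have := le_has_rint _ (has_rintZ (expR (- 2)) h) (has_rint_rGamma x0).
rewrite mulr1 => H; apply: (lt_le_trans (expR_gt0 (- 2))); apply: H => t.
rewrite indicE; case: (boolP (t \in _)) => [/set_mem/=|_]; last by rewrite mulr0 rgkernel_ge0.
rewrite in_itv/= => /andP[t1 t2]; rewrite mulr1 rgkernel_gt0E ?(lt_trans ltr01)//.
rewrite -[leLHS]mul1r ler_pM ?expR_ge0// ?ler_expR ?lerN2//.
rewrite -[leLHS]expR0 ler_expR mulr_ge0 ?subr_ge0//.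
by rewrite ln_ge0// ltW.
Qed.

(** The right-hand side is 4 (exp(u/2) - exp(-u/2))^2. At u = ln(t / a) it becomes 4 (t/a - 2 +
    a/t), whose integral against the Gamma kernel involves Gamma only at a - 1, a and a + 1. *)
Lemma sqr_le_expR u : u ^+ 2 <= 4 * (expR u - 2 + expR (- u)).
Proof.
pose w := u / 2.
have -> : u = w + w by rewrite /w; field.
rewrite (opprD w w) !expRD.
have ee : expR w * expR (- w) = 1 by rewrite -expRD subrr expR0.
have : w ^+ 2 <= (expR w - expR (- w)) ^+ 2.
  wlog w0 : w {ee} / 0 <= w => [H|].
    have [/H//|/ltW w0] := leP 0 w.
    have := H (- w); rewrite oppr_ge0 opprK => /(_ w0).
    by rewrite sqrrN -(sqrrN (_ - expR w)) opprB.
  have h1 := expR_ge1Dx w.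
  have h2 : expR (- w) <= 1 by rewrite -expR0 ler_expR oppr_le0.
  rewrite ler_sqr ?nnegrE//; lra.
move: (expR w) (expR (- w)) ee => e f ee H.
have -> : e * e - 2 + f * f = (e - f) ^+ 2 by rewrite sqrrB ee; ring.
by rewrite (_ : (w + w) ^+ 2 = 4 * w ^+ 2) ?ler_pM2l//; ring.
Qed.

(* The law t^(a-1) exp(-t) dt concentrates near t = a, where t^(iy) is almost *)
(* constant, so that a^(-iy) Gamma(a + iy) has a positive real part.          *)
Lemma cGamma_neq0_large a y : 1 < a -> 2 * y ^+ 2 < a - 1 -> cGamma (a +i* y) != 0.
Proof.
move=> a1 ya; have a0 : 0 < a by lra.
have am : 0 < a - 1 by lra.
have a10 : 0 < a + 1 by lra.
have Ga : 0 < rGamma a by rewrite rGamma_gt0// ltW.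
have G1 : rGamma (a + 1) = a * rGamma a by exact: rGammaS.
have G2 : rGamma a = (a - 1) * rGamma (a - 1) by rewrite -(rGammaS am) subrK.
have az : 0 < complex.Re (a +i* y) by [].
have H := has_cintZ (cpow a (0 -i* y)) (has_cint_gkernel1 az).
(* This is the kernel times 1 - 2 y^2 (t/a - 2 + a/t), a lower bound for the kernel times cos(y ln(t
   / a)) by [cos_ge_quad] and [sqr_le_expR]. Its integral is Gamma(a) (1 - 2 y^2 / (a - 1)). *)
pose low t := (1 + 4 * y ^+ 2) * rgkernel a t - 2 * y ^+ 2 * (a^-1 * rgkernel (a + 1) t + a * rgkernel (a - 1) t).
have L : has_rint leb low ((1 + 4 * y ^+ 2) * rGamma a -
    2 * y ^+ 2 * (a^-1 * rGamma (a + 1) + a * rGamma (a - 1))).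
  apply: has_rintB; first exact/has_rintZ/has_rint_rGamma.
  apply: has_rintZ; apply: has_rintD; apply: has_rintZ; exact: has_rint_rGamma.
apply: contraTneq (ya) => G0; rewrite -leNgt.
have H' := H.1; rewrite G0 mulr0 in H'.
have : (1 + 4 * y ^+ 2) * rGamma a -
    2 * y ^+ 2 * (a^-1 * rGamma (a + 1) + a * rGamma (a - 1)) <= 0.
  apply: (le_has_rint _ L H') => t; rewrite /low.
  have [t0|t0] := leP t 0; first by rewrite gkernel_le0// !rgkernel_le0E// !mulr0 addr0 mulr0 subr0.
  pose u := ln t - ln a.
  have tE : expR u = t / a by rewrite /u expRB !lnK.
  have tNE : expR (- u) = a / t by rewrite /u opprB expRB !lnK.
  have -> : complex.Re (cpow a (0 -i* y) * gkernel (a +i* y) 1 t) = rgkernel a t * cos (y * u).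
    have -> : cos (y * u) = cos (y * ln t) * cos (y * ln a) + sin (y * ln t) * sin (y * ln a).
      by rewrite /u mulrBr cosB.
    rewrite gkernel_gt0// rgkernel_gt0E// mul1r /cpow/= subr0 mulNr cosN sinN mul0r expR0.
    by ring.
  have -> : rgkernel (a - 1) t = rgkernel a t / t.
    by rewrite -{2}(subrK 1 a) rgkernelS mulrC mulKf// gt_eqF.
  rewrite rgkernelS.
  have := sqr_le_expR u; rewrite tE tNE => Hu.
  have := cos_ge_quad (y * u) => Hc.
  have Hr := rgkernel_ge0 a t.
  have -> : (1 + 4 * y ^+ 2) * rgkernel a t - 2 * y ^+ 2 * (a^-1 * (t * rgkernel a t) + a * (rgkernel a t / t))
     = rgkernel a t * (1 - 2 * y ^+ 2 * (t / a - 2 + a / t)).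
    by field; rewrite !gt_eqF.
  apply: ler_wpM2l => //; apply: le_trans Hc; rewrite exprMn lerD2l lerN2.
  have y2 : 0 <= y ^+ 2 by rewrite sqr_ge0.
  move: (ler_wpM2l y2 Hu); move: (t / a - 2 + a / t) => q; clear; lra.
have -> : rGamma (a - 1) = rGamma a / (a - 1) by rewrite G2 mulrC mulKf// gt_eqF.
have -> : (1 + 4 * y ^+ 2) * rGamma a -
    2 * y ^+ 2 * (a^-1 * rGamma (a + 1) + a * (rGamma a / (a - 1))) =
    rGamma a * (1 - 2 * y ^+ 2 / (a - 1)).
  by rewrite G1; field; rewrite !gt_eqF.
rewrite pmulr_rle0// subr_le0 ler_pdivlMr// mul1r => h.
exact: h.
Qed.

(** A zero at x + iy yields zeros at x + n + iy for all n; any n > 2 y^2 + 1 brings this into the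
    range of [cGamma_neq0_large]. *)
Lemma cGamma_neq0 z : 0 < complex.Re z -> cGamma z != 0.
Proof.
case: z => x y /= x0; apply/negP => /eqP G0.
have Gn n : cGamma ((x + n%:R) +i* y) = 0.
  elim: n => [|n ih]; first by rewrite addr0.
  have <- : ((x + n%:R) +i* y) + 1 = (x + n.+1%:R) +i* y.
    by apply/eqP; rewrite eq_complex /= addr0 -addrA natr1 !eqxx.
  by apply: cGamma0S => //=; rewrite ltr_wpDr.
pose n := (Num.truncn (2 * y ^+ 2 + 1)).+1.
have nb : 2 * y ^+ 2 + 1 < n%:R by exact: truncnS_gt.
have y2 : 0 <= y ^+ 2 by exact: sqr_ge0.
have := @cGamma_neq0_large (x + n%:R) y; rewrite Gn eqxx => /(_ _ _)/negP; apply; lra.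
Qed.

End gamma_nonvanishing.

(** * The complex matrix-variate Gamma integral *)

Section hermitian_coordinates.
Context {R : realType}.
Local Notation C := R[i].
Local Notation leb := (@lebesgue_measure R).
Local Notation RR := (measurableTypeR R).
Local Notation pw n := (power_measure leb n).
Local Notation hm p := (power_measure (pw p) p).

(** The corner comes last so that it is integrated first. Real parts of the border complete the
    first row of the array; imaginary parts are prepended to the rows of the smaller array, as
    prescribed by the layout of [hermcoord]. *)
Definition herm_cons p (t : hermcoord p * ((p.-tuple RR * p.-tuple RR) * RR)) :
    @hermcoord R p.+1 :=
  cons_pair (cons_pair (t.2.2, t.2.1.1), zip_with (@cons_pair _ RR p) (t.2.1.2, t.1)).

Lemma mpreserving_herm_cons p :
  mpreserving (prodm (hm p) (prodm (prodm (pw p) (pw p)) leb)) (hm p.+1) (@herm_cons p).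
Proof.
have S1 := mpreserving_swap (prodm (pw p) (pw p)) leb.
have S2 := mpreserving_prodA leb (pw p) (pw p).
have S3 := mpreserving_prod (mpreserving_id (hm p)) (mpreserving_comp S1 S2).
have S4 := mpreserving_swap (hm p) (prodm (prodm leb (pw p)) (pw p)).
have S5 := mpreserving_prodA' (prodm leb (pw p)) (pw p) (hm p).
have S6 := mpreserving_prod (mpreserving_cons leb p)
  (@mpreserving_zip_with R _ _ _ _ _ _ leb (pw p) (pw p.+1) (@cons_pair _ RR p) p (mpreserving_cons leb p)).
have S7 := mpreserving_cons (pw p.+1) p.
apply: eq_mpreserving (mpreserving_comp S3 (mpreserving_comp S4
  (mpreserving_comp S5 (mpreserving_comp S6 S7)))).
by [].
Qed.

Lemma conjC_NIm (a b : R) : Num.conj (a -i* b : C) = a +i* b.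
Proof. by apply: (@etrans _ _ (conjc (a -i* b))); rewrite //= opprK. Qed.

Lemma hermmx_cons p (t : hermcoord p * ((p.-tuple RR * p.-tuple RR) * RR)) :
  hermmx (herm_cons t) = hblock t.2.2 (cvec t.2.1) (hermmx t.1).
Proof.
case: t => W [[x y] z]; apply/(@matrixP _ (1 + p) (1 + p)) => i j; rewrite /hblock.
have c00 : tnth (tnth (herm_cons (W, (x, y, z))) ord0) ord0 = z.
  by rewrite /herm_cons /cons_pair /= !tnth0.
have c0S k : tnth (tnth (herm_cons (W, (x, y, z))) ord0) (lift ord0 k) = tnth x k.
  by rewrite /herm_cons /cons_pair /= tnth0 tnthS.
have cS0 k : tnth (tnth (herm_cons (W, (x, y, z))) (lift ord0 k)) ord0 = tnth y k.
  by rewrite /herm_cons /cons_pair /= tnthS tnth_mktuple tnth0.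
have cSS k l : tnth (tnth (herm_cons (W, (x, y, z))) (lift ord0 k)) (lift ord0 l) = tnth (tnth W k) l.
  by rewrite /herm_cons /cons_pair /= tnthS tnth_mktuple tnthS.
have r1 k : rshift 1 k = lift ord0 k :> 'I_(1 + p) by exact: val_inj.
have r0 (k : 'I_1) : lshift p k = ord0 :> 'I_(1 + p) by apply: val_inj; rewrite /= ord1.
rewrite [LHS]mxE; case: (@split_ordP 1 p i) => k ->; case: (@split_ordP 1 p j) => l ->.
- by rewrite block_mxEul !r0 c00 mxE !ord1 eqxx mulr1n.
- by rewrite block_mxEur !(r0, r1) c0S cS0 !mxE /= [RHS]conjC_NIm.
- by rewrite block_mxEdl !(r0, r1) c0S cS0 !mxE.
- by rewrite block_mxEdr !r1 !cSS !mxE /= /bump /= !add1n !ltnS.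
Qed.

Lemma ctr_hermmx p (t : hermcoord p) : (hermmx t)^t* = hermmx t :> 'M[C]_p.
Proof.
apply/matrixP => i j; rewrite !mxE.
case: (ltngtP i j) => [ij|ij|ij].
- exact: conjC_NIm.
- by [].
- by rewrite (val_inj ij); exact: conjC_real.
Qed.

Lemma mxmeasurable_hermmx p : mxmeasurable (@hermmx R p).
Proof.
move=> i j; under eq_fun do rewrite mxE.
have m k l : measurable_fun setT (fun t : hermcoord p => tnth (tnth t k) l : R).
  exact: (measurableT_comp (@measurable_tnth _ RR p l) (@measurable_tnth _ _ p k)).
case: ltngtP => _; split => //=; try exact: m.
by apply: measurable_funN; exact: m.
Qed.

(** An inductive Sylvester criterion. It replaces a condition on all vectors by finitely many
    determinant inequalities, which makes the cone of positive definite matrices measurable. *)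
Lemma posdef_schurP n (A : 'M[C]_(1 + n)) : A^t* = A ->
  posdefmx A <-> posdefmx (drsubmx A) /\ 0 < complex.Re (\det A).
Proof.
move=> hA; have [E hW] := hermitian_hblock hA.
set y := complex.Re _ in E; set v := dlsubmx A in E; set W := drsubmx A in E hW *.
pose s := y - qform (invmx W) v.
have yE : y = s + qform (invmx W) v by rewrite subrK.
have K : posdefmx W -> (posdefmx A <-> 0 < complex.Re (\det A)).
  move=> pW; have [iff dE] := posdef_hblock_schur s v pW.
  rewrite E yE dE iff; have [aW ->] := absdet_posdef pW.
  by rewrite -realcM /= pmulr_lgt0.
split=> [pA|[pW]]; last by rewrite K.
have pW : posdefmx W by move: (pA); rewrite E => /posdef_hblock_corner[].
by split=> //; apply/K.
Qed.

Lemma measurable_posdef d (T : measurableType d) n (F : T -> 'M[C]_n) :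
  mxmeasurable F -> (forall t, (F t)^t* = F t) -> measurable [set t | posdefmx (F t)].
Proof.
elim: n F => [|n ih] F mF hF.
  rewrite (_ : [set _ | _] = setT)//; apply/seteqP; split=> // t _.
  apply/posdefP; split; first exact: hF.
  by move=> v /eqP[]; apply/matrixP => -[].
pose G t : 'M[C]_(1 + n) := F t.
have hG t : (G t)^t* = G t by exact: hF.
have mS : mxmeasurable (fun t => drsubmx (G t)).
  move=> i j; rewrite (_ : (fun t => _) = (fun t => F t (rshift 1 i) (rshift 1 j)))//.
  by apply/funext => t; rewrite !mxE.
have hS t : (drsubmx (G t))^t* = drsubmx (G t) by have [] := hermitian_hblock (hG t).
rewrite (_ : [set _ | _] = [set t | posdefmx (drsubmx (G t))] `&`
   (fun t => complex.Re (\det (F t))) @^-1` `]0, +oo[%classic).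
  apply: measurableI; first exact: ih.
  rewrite -[X in measurable X]setTI; exact: (cmeasurable_det mF).1.
apply/seteqP; split=> t /=; rewrite in_itv /= andbT.
  exact: (posdef_schurP (hG t)).1.
exact: (posdef_schurP (hG t)).2.
Qed.

Definition posdef_coord p : set (@hermcoord R p) := [set t | posdefmx (hermmx t)].

Lemma measurable_posdef_coord p : measurable (@posdef_coord p).
Proof. by apply: measurable_posdef; [exact: mxmeasurable_hermmx|exact: ctr_hermmx]. Qed.

Definition mxgkernel p (alpha : C) (A : 'M[C]_p) (t : hermcoord p) : C :=
  (\1_(@posdef_coord p) t)%:C *
  (cpow (absdet (hermmx t)) (alpha - p%:R) *
   (expR (- complex.Re (\tr (A *m hermmx t))))%:C).

(** The parameter matrix may vary with the point because in [joint_kernel] it is itself a variable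
    of integration. *)
Lemma cmeasurable_mxgkernel_comp d (T : measurableType d) p alpha (A : T -> 'M[C]_p)
    (phi : T -> hermcoord p) : mxmeasurable A -> measurable_fun setT phi ->
  cmeasurable (fun z => mxgkernel alpha (A z) (phi z)).
Proof.
move=> mA mphi; have mh : mxmeasurable (fun z => hermmx (phi z)).
  by move=> i j; exact: (cmeasurable_comp mphi (mxmeasurable_hermmx i j)).
apply: cmeasurableM.
  have mi := cmeasurable_real (measurable_indic (D := setT) (@measurable_posdef_coord p)).
  exact: (cmeasurable_comp mphi (mi R)).
apply: cmeasurableM.
  by apply: cmeasurable_cpow; exact: measurable_absdet.
apply: cmeasurable_real; apply: measurableT_comp => //; apply: measurable_funN.
have [] // : cmeasurable (fun z => \tr (A z *m hermmx (phi z))).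
by apply: cmeasurable_trace; exact: mxmeasurableM.
Qed.

Lemma cmeasurable_mxgkernel p alpha (A : 'M[C]_p) : cmeasurable (mxgkernel alpha A).
Proof.
apply: (@cmeasurable_mxgkernel_comp _ (hermcoord p) p alpha (fun=> A) id) => //.
Qed.

Lemma norm_mxgkernel p alpha (A : 'M[C]_p) t :
  `|mxgkernel alpha A t| = mxgkernel (complex.Re alpha)%:C A t.
Proof.
rewrite /mxgkernel normrM [X in _ * X]normrM norm_expR norm_cpow norm_real//.
congr (_ * (cpow _ _ * _)).
by rewrite raddfB /= rmorphB /= (_ : (complex.Re p%:R)%:C = p%:R) // -(rmorph_nat (real_complex R)).
Qed.

Lemma mxgkernel_posdef p alpha (A : 'M[C]_p) t : posdefmx (hermmx t) ->
  mxgkernel alpha A t = cpow (absdet (hermmx t)) (alpha - p%:R) *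
    (expR (- complex.Re (\tr (A *m hermmx t))))%:C.
Proof. by move=> pt; rewrite /mxgkernel indicE mem_set// mul1r. Qed.

Lemma mxgkernel_notposdef p alpha (A : 'M[C]_p) t : ~ posdefmx (hermmx t) ->
  mxgkernel alpha A t = 0.
Proof. by move=> pt; rewrite /mxgkernel indicE memNset// mul0r. Qed.

End hermitian_coordinates.

(** * Recursion of the matrix Gamma integral on the size *)

Section matrix_gamma.
Context {R : realType}.
Local Notation C := R[i].
Local Notation leb := (@lebesgue_measure R).
Local Notation RR := (measurableTypeR R).
Local Notation pw n := (power_measure leb n).
Local Notation hm p := (power_measure (pw p) p).

Lemma cpow1l (z : C) : cpow 1 z = 1.
Proof. by rewrite /cpow ln1 !mulr0 expR0 cos0 sin0 mul1r. Qed.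

Lemma absdet_gt0 p (A : 'M[C]_p) : posdefmx A -> 0 < absdet A.
Proof. by move=> /absdet_posdef[]. Qed.

(** The two new factors are those of the induction: pi^p from the Gaussian integral over the border,
    Gamma(alpha - p) from the corner. *)
Lemma cmxGammaS p (alpha : C) :
  cmxGamma p.+1 alpha = (pi ^+ p)%:C * cGamma (alpha - p%:R) * cmxGamma p alpha.
Proof.
rewrite /cmxGamma big_ord_recr /=.
have -> : ((p.+1 * p)./2 = p + (p * p.-1)./2)%N.
  case: p => [//|p]; rewrite (_ : p.+2 * p.+1 = p.+1.*2 + p.+1 * p)%N; last by rewrite -muln2 -mulnDr mulnC.
  by rewrite halfD odd_double /= doubleK.
rewrite exprD realcM.
by move: (_%:C) (_%:C) (cGamma _) (\prod_(i < p) _) => a b c d; ring.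
Qed.

Lemma cmxGamma_neq0 p (alpha : C) : p%:R - 1 < complex.Re alpha -> cmxGamma p alpha != 0.
Proof.
elim: p => [|p ih] h.
  by rewrite /cmxGamma big_ord0 mulr1 expr0 oner_eq0.
rewrite cmxGammaS mulf_neq0//; last first.
  by apply: ih; apply: le_lt_trans h; rewrite lerD2r ler_nat.
rewrite mulf_neq0//.
  by rewrite (inj_eq (@complexI R) _ 0) expf_neq0// gt_eqF// pi_gt0.
apply: cGamma_neq0; rewrite raddfB /= (_ : complex.Re p%:R = p%:R :> R).
  by rewrite subr_gt0; move: h; rewrite -natr1 addrK.
by rewrite -(rmorph_nat (real_complex R)).
Qed.

Section induction_step.
Variable p : nat.
Variables (a : R) (b : 'cV[C]_p) (D : 'M[C]_p).
Hypothesis a_gt0 : 0 < a.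
Let S := D - a^-1%:C *: (b *m b^t*).
Let F (al : C) t := mxgkernel al (hblock a b D : 'M[C]_p.+1) (@herm_cons R p t).

(** Since |Y| = s |W|, the exponent al - (p + 1) is shared: for s it belongs to a Gamma kernel of
    parameter al - p, for |W| to a kernel of size p and parameter al - 1. For s <= 0 both sides
    vanish. *)
Lemma mxgkernel_cons al (W : hermcoord p) (v : p.-tuple RR * p.-tuple RR) (s : R) :
  posdefmx (hermmx W : 'M[C]_p) ->
  F al (W, (v, s + qform (invmx (hermmx W)) (cvec v))) =
  gkernel (al - p%:R) a s * (mxgkernel (al - 1) S W *
    (expR (- qform (a%:C *: invmx (hermmx W)) (cvec v + a^-1%:C *: (hermmx W *m b))))%:C).
Proof.
move=> pW; have [iff dE] := posdef_hblock_schur s (cvec v) pW.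
have a0 : a != 0 by rewrite gt_eqF.
have [hW _] := (posdefP _).1 pW.
have E := hermmx_cons (W, (v, s + qform (invmx (hermmx W)) (cvec v))).
rewrite /= in E.
have [s0|s0] := leP s 0.
  rewrite gkernel_le0// mul0r /F mxgkernel_notposdef// E iff.
  by apply/negP; rewrite -leNgt.
rewrite gkernel_gt0// /F mxgkernel_posdef; last by rewrite E iff.
rewrite mxgkernel_posdef// E Re_trace_hblock ?posdef_unit// -/S.
rewrite (absdetM_real (ltW s0) dE) cpowM ?absdet_gt0//.
rewrite (_ : al - 1 - p%:R = al - p.+1%:R); last by rewrite -natr1; ring.
rewrite (_ : al - p%:R - 1 = al - p.+1%:R); last by rewrite -natr1; ring.
rewrite opprD opprD !expRD !realcM.
move: (cpow _ _) (cpow _ _) (expR _)%:C (expR _)%:C (expR _)%:C => c1 c2 e1 e2 e3; ring.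
Qed.

Lemma Re_subn (z : C) n : complex.Re (z - n%:R) = complex.Re z - n%:R.
Proof.
by rewrite raddfB /= (_ : complex.Re n%:R = n%:R :> R)// -(rmorph_nat (real_complex R)).
Qed.

Definition gfun1 al (W : hermcoord p) (v : p.-tuple RR * p.-tuple RR) : C :=
  cpow a (- (al - p%:R)) * cGamma (al - p%:R) * (mxgkernel (al - 1) S W *
    (expR (- qform (a%:C *: invmx (hermmx W)) (cvec v + a^-1%:C *: (hermmx W *m b))))%:C).

Lemma has_cint_corner al W v : p%:R < complex.Re al ->
  has_cint leb (fun z => F al (W, (v, z))) (gfun1 al W v).
Proof.
move=> al_gt; have [pW|npW] := pselect (posdefmx (hermmx W : 'M[C]_p)); last first.
  rewrite /gfun1 mxgkernel_notposdef// mul0r mulr0.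
  apply: eq_has_cint (has_cint0 leb) => z; rewrite /F mxgkernel_notposdef//.
  by rewrite hermmx_cons => /posdef_hblock_corner[_].
pose q := qform (invmx (hermmx W)) (cvec v).
have mF : cmeasurable (fun z : RR => F al (W, (v, z))).
  have m1 : measurable_fun setT (fun z : RR => (W, (v, z))).
    apply: measurable_fun_pair; first exact: measurable_cst.
    by apply: measurable_fun_pair; first exact: measurable_cst.
  apply: (cmeasurable_comp (measurableT_comp (mpreserving_herm_cons p).1 m1)).
  exact: cmeasurable_mxgkernel.
(* Translating by q replaces the corner by the Schur complement s as variable. *)
apply: (has_cint_mpreserving (mpreserving_shift q) mF).
have al0 : 0 < complex.Re (al - p%:R) by rewrite Re_subn subr_gt0.
have := has_cintZr (mxgkernel (al - 1) S W *
    (expR (- qform (a%:C *: invmx (hermmx W)) (cvec v + a^-1%:C *: (hermmx W *m b))))%:C)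
  (has_cint_gkernel al0 a_gt0).
by apply: eq_has_cint => s; rewrite [RHS]/= -mxgkernel_cons.
Qed.

Definition gfun2 al (W : hermcoord p) : C :=
  (pi ^+ p)%:C * cGamma (al - p%:R) * cpow a (- al) * mxgkernel al S W.

(** The Gaussian form a W^-1 has determinant a^p / |W|, so the border contributes pi^p a^(-p) |W|:
    the factor |W| restores the parameter al - 1 to al, and a^(-p) turns a^(p - al) into a^(-al). *)
Lemma has_cint_border al W :
  has_cint (prodm (pw p) (pw p)) (gfun1 al W) (gfun2 al W).
Proof.
have [pW|npW] := pselect (posdefmx (hermmx W : 'M[C]_p)); last first.
  rewrite /gfun2 mxgkernel_notposdef// mulr0.
  by apply: eq_has_cint (has_cint0 _) => z; rewrite /gfun1 mxgkernel_notposdef// mul0r mulr0.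
have pM : posdefmx (a%:C *: invmx (hermmx W) : 'M[C]_p).
  exact: (posdefZ a_gt0 (posdef_inv pW)).
have := has_cintZ (cpow a (- (al - p%:R)) * cGamma (al - p%:R) * mxgkernel (al - 1) S W)
  (has_cint_gaussmx_shift (a^-1%:C *: (hermmx W *m b)) pM).
have -> : cpow a (- (al - p%:R)) * cGamma (al - p%:R) * mxgkernel (al - 1) S W *
    (pi ^+ p / absdet (a%:C *: invmx (hermmx W)))%:C = gfun2 al W.
  rewrite /gfun2 !mxgkernel_posdef//.
  have aW := absdet_gt0 pW.
  have dE : absdet (a%:C *: invmx (hermmx W)) = a ^+ p / absdet (hermmx W).
    rewrite -[RHS]mulr1 -(_ : absdet (1%:M : 'M[C]_0) = 1); last first.
      by rewrite /absdet det_mx00 normr1.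
    apply: absdetM_real; first by rewrite divr_ge0// ?exprn_ge0 ?ltW.
    rewrite detZ det_inv (absdet_posdef pW).2 det_mx00 mulr1 realcM fmorphV.
    by rewrite rmorphXn.
  have aC : (a ^+ p)%:C != 0 :> C by rewrite (inj_eq (@complexI R) _ 0) expf_neq0// gt_eqF.
  rewrite dE opprB [cpow a (p%:R - al)]cpowD cpow_nat//.
  rewrite (_ : al - 1 - p%:R = (al - p%:R) - 1); last by ring.
  rewrite [cpow _ (al - p%:R - 1)]cpowD [cpow _ (- 1)]cpowN cpow1//.
  rewrite (_ : (pi ^+ p / (a ^+ p / absdet (hermmx W)))%:C =
     (pi ^+ p)%:C / (a ^+ p)%:C * (absdet (hermmx W))%:C); last first.
    by rewrite -fmorphV -!realcM; congr _%:C; field; rewrite !gt_eqF// exprn_gt0.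
  have aWC : (absdet (hermmx W))%:C != 0 :> C by rewrite (inj_eq (@complexI R) _ 0) gt_eqF.
  move: (pi ^+ p)%:C (a ^+ p)%:C (absdet _)%:C (cGamma _) (cpow _ _) (cpow _ _) (expR _)%:C aC aWC.
  by move=> x1 x2 x3 x4 x5 x6 x7 h1 h2; field; rewrite h1.
by apply: eq_has_cint => v; rewrite /gfun1 !mulrA.
Qed.

End induction_step.

Theorem has_cint_mxgkernel p (alpha : C) (A : 'M[C]_p) : posdefmx A ->
  p%:R - 1 < complex.Re alpha ->
  has_cint (hm p) (mxgkernel alpha A) (cpow (absdet A) (- alpha) * cmxGamma p alpha).
Proof.
elim: p alpha A => [|p ih] alpha A pA h.
  have -> : cpow (absdet A) (- alpha) * cmxGamma 0 alpha = 1.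
    by rewrite /cmxGamma big_ord0 expr0 !mulr1 /absdet det_mx00 normr1 cpow1l.
  have E t : mxgkernel alpha A t = 1.
    rewrite mxgkernel_posdef; last first.
      apply/posdefP; split; first exact: ctr_hermmx.
      by move=> v /eqP[]; apply/matrixP => -[].
    rewrite /absdet det_mx00 normr1 cpow1l mul1r (_ : _ *m _ = 0); last by apply/matrixP => -[].
    by rewrite raddf0 /= oppr0 expR0.
  apply: (@eq_has_cint _ _ _ _ (fun=> 1)) => [t|]; first by rewrite E.
  by apply/has_cint_real; exact: has_rint_dirac.
have [hA _] := (posdefP A).1 pA; have [EA _] := hermitian_hblock (n := p) hA.
set a := complex.Re (A 0 0) in EA; set b := dlsubmx _ in EA; set D := drsubmx _ in EA.
have pA' := pA; rewrite EA in pA'; have [a0 pS dS] := posdef_hblock_compl pA'.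
set S := D - _ in pS dS.
have al_gt (al : C) : p.+1%:R - 1 < complex.Re al -> p%:R < complex.Re al.
  by rewrite -natr1 addrK.
apply: (has_cint_mpreserving (mpreserving_herm_cons p)).
  exact: cmeasurable_mxgkernel.
pose F (al : C) t := mxgkernel al (hblock a b D : 'M[C]_p.+1) (@herm_cons R p t).
have mF (al : C) : cmeasurable (F al).
  apply: (cmeasurable_comp (mpreserving_herm_cons p).1).
  exact: cmeasurable_mxgkernel.
have step1 (al : C) W : p%:R < complex.Re al ->
    has_cint (prodm (prodm (pw p) (pw p)) leb) (fun t => F al (W, t)) (gfun2 a b D al W).
  move=> hal; have hre : p%:R < complex.Re (complex.Re al)%:C by [].
  have B0 := has_cint_border b D a0 (complex.Re al)%:C W.
  have B1 := has_cint_border b D a0 al W.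
  have C0 v := has_cint_corner b D a0 W v hre.
  have C1 v := has_cint_corner b D a0 W v hal.
  refine (@has_cint_prod _ _ _ _ R _ _ (fun t => F al (W, t)) (fun t => F (complex.Re al)%:C (W, t))
    _ _ _ _ _ _ C0 B0 C1 B1).
  - apply: (cmeasurable_comp _ (mF al)).
    by apply: measurable_fun_pair; first exact: measurable_cst.
  - by move=> t; exact: norm_mxgkernel.
have step2 (al : C) : p%:R < complex.Re al -> has_cint (hm p) (gfun2 a b D al)
    (cpow (absdet A) (- al) * cmxGamma p.+1 al).
  move=> hal; have hal' : p%:R - 1 < complex.Re al by apply: lt_trans hal; rewrite gtrDl ltrN10.
  have := has_cintZ ((pi ^+ p)%:C * cGamma (al - p%:R) * cpow a (- al)) (ih al S pS hal').
  have -> : absdet A = a * absdet S by rewrite EA; apply: absdetM_real => //; exact: ltW.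
  rewrite cpowM ?absdet_gt0// cmxGammaS.
  congr (has_cint _ _ _).
  move: (pi ^+ p)%:C (cGamma _) (cpow _ _) (cpow _ _) (cmxGamma _ _) => x1 x2 x3 x4 x5; ring.
have hal := al_gt _ h; have hre : p%:R < complex.Re (complex.Re alpha)%:C by [].
have FE : mxgkernel alpha A \o @herm_cons R p = F alpha.
  by apply/funext => t; rewrite /F -EA.
rewrite FE.
refine (@has_cint_prod _ _ _ _ R _ _ (F alpha) (F (complex.Re alpha)%:C) _ _ _ _ (mF _) _
  (fun W => step1 _ W hre) (step2 _ hre) (fun W => step1 _ W hal) (step2 _ hal)).
by move=> t; exact: norm_mxgkernel.
Qed.

End matrix_gamma.

(** * The type-2 Dirichlet integral *)

Section dirichlet_integral.
Context {R : realType}.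
Local Notation C := R[i].
Local Notation leb := (@lebesgue_measure R).
Local Notation RR := (measurableTypeR R).
Local Notation hm p := (power_measure (power_measure leb p) p).

Lemma has_cint_power d (T : measurableType d) (mu : {sigma_finite_measure set T -> \bar R})
    k (f : 'I_k -> T -> C) (v : 'I_k -> C) : (forall j, has_cint mu (f j) (v j)) ->
  has_cint (power_measure mu k) (fun t => \prod_j f j (tnth t j)) (\prod_j v j).
Proof.
elim: k f v => [|k ih] f v h.
  apply: (@eq_has_cint _ _ _ _ (fun=> 1)) => [t|]; first by rewrite big_ord0.
  by rewrite big_ord0; apply/has_cint_real; exact: has_rint_dirac.
have mf : cmeasurable (fun t : k.+1.-tuple T => \prod_j f j (tnth t j)).
  apply: cmeasurable_prod => j.
  exact: (cmeasurable_comp (@measurable_tnth _ T k.+1 j) (has_cint_measurable (h j))).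
apply: (has_cint_mpreserving (mpreserving_cons mu k) mf).
rewrite big_ord_recl.
have := has_cint_tensor (h ord0) (ih _ _ (fun j => h (lift ord0 j))).
apply: eq_has_cint => -[x t]; rewrite /= big_ord_recl tnth0; congr (_ * _).
by apply: eq_bigr => j _; rewrite tnthS.
Qed.

Section joint_kernel.
Variables (p k : nat).

Definition dirichlet_weight (alpha : 'I_k -> C) (t : k.-tuple (@hermcoord R p)) : C :=
  \prod_j ((\1_(@posdef_coord R p) (tnth t j))%:C *
           cpow (absdet (hermtuple t j)) (alpha j - p%:R)).

(** Written so that at fixed Y the variables X_j separate; [joint_kernelE] regroups it as a matrix
    Gamma kernel in Y at fixed X_j. *)
Definition joint_kernel (alpha : 'I_k -> C) (s : C)
    (z : @hermcoord R p * k.-tuple (@hermcoord R p)) : C :=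
  mxgkernel s 1%:M z.1 * \prod_j mxgkernel (alpha j) (hermmx z.1) (tnth z.2 j).

(** The exponentials combine because tr((I + X_1 + ... + X_k) Y) is the sum of tr(Y) and of the tr(Y
    X_j). *)
Lemma joint_kernelE alpha s Y t : joint_kernel alpha s (Y, t) =
  dirichlet_weight alpha t * mxgkernel s (1%:M + \sum_j hermtuple t j) Y.
Proof.
pose e j : C := (expR (- complex.Re (\tr (hermmx Y *m hermtuple t j))))%:C.
have E : \prod_j mxgkernel (alpha j) (hermmx Y) (tnth t j) =
    dirichlet_weight alpha t * \prod_j e j.
  rewrite /dirichlet_weight -big_split; apply: eq_bigr => j _.
  by rewrite /mxgkernel mulrA.
have X : (expR (- complex.Re (\tr ((1%:M + \sum_j hermtuple t j) *m hermmx Y))))%:C =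
    (expR (- complex.Re (\tr (1%:M *m hermmx Y))))%:C * \prod_j e j.
  have -> : \prod_j e j = (expR (- \sum_j complex.Re (\tr (hermmx Y *m hermtuple t j))))%:C.
    by rewrite -sumrN expR_sum rmorph_prod.
  rewrite -realcM -expRD; congr (expR _)%:C; rewrite -opprD; congr (- _).
  rewrite mulmxDl mxtraceD [LHS]raddfD; congr (_ + _).
  have -> : \tr ((\sum_j hermtuple t j) *m hermmx Y) =
      \sum_j \tr (hermtuple t j *m hermmx Y) by rewrite mulmx_suml; exact: raddf_sum.
  rewrite [LHS]raddf_sum; apply: eq_bigr => j _.
  exact: (congr1 (@complex.Re R) (mxtrace_mulC _ _)).
have alg (x1 x2 x3 x4 x5 : C) : x1 * (x2 * x3) * (x4 * x5) = x4 * (x1 * (x2 * (x3 * x5))).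
  by ring.
have KE (e' : C) : (expR (- complex.Re (\tr ((1%:M + \sum_j hermtuple t j) *m hermmx Y))))%:C = e' ->
    mxgkernel s (1%:M + \sum_j hermtuple t j) Y =
    (\1_(@posdef_coord R p) Y)%:C * (cpow (absdet (hermmx Y)) (s - p%:R) * e').
  by move=> <-.
exact: etrans (congr1 (fun x => mxgkernel s 1%:M Y * x) E)
  (etrans (alg _ _ _ _ _) (esym (congr1 (fun x => dirichlet_weight alpha t * x) (KE _ X)))).
Qed.

Lemma norm_joint_kernel alpha s z : `|joint_kernel alpha s z| =
  joint_kernel (fun j => (complex.Re (alpha j))%:C) (complex.Re s)%:C z.
Proof.
rewrite /joint_kernel normrM norm_mxgkernel normr_prod; congr (_ * _).
by apply: eq_bigr => j _; rewrite norm_mxgkernel.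
Qed.

Lemma cmeasurable_joint_kernel alpha s : cmeasurable (joint_kernel alpha s).
Proof.
apply: cmeasurableM.
  exact: (cmeasurable_comp measurable_fst (cmeasurable_mxgkernel s 1%:M)).
apply: cmeasurable_prod => j; apply: cmeasurable_mxgkernel_comp.
  by move=> i l; exact: (cmeasurable_comp measurable_fst (mxmeasurable_hermmx i l)).
exact: (measurableT_comp (@measurable_tnth _ (hermcoord p) k j) measurable_snd).
Qed.

Definition joint_marginal (alpha : 'I_k -> C) s (Y : @hermcoord R p) : C :=
  mxgkernel (s - \sum_j alpha j) 1%:M Y * \prod_j cmxGamma p (alpha j).

Lemma cpow_prod (r : R) (alpha : 'I_k -> C) :
  \prod_j cpow r (alpha j) = cpow r (\sum_j alpha j).
Proof.
elim: k alpha => [|n ih] alpha; first by rewrite !big_ord0 cpow0.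
by rewrite !big_ord_recl ih cpowD.
Qed.

(** Each X_j contributes |Y|^(-alpha_j) Gamma_p(alpha_j), and these powers of |Y| lower the
    parameter [s] by the sum of the alpha_j. *)
Lemma has_cint_joint_marginal alpha s Y : (forall j, p%:R - 1 < complex.Re (alpha j)) ->
  has_cint (power_measure (hm p) k) (fun t => joint_kernel alpha s (Y, t))
    (joint_marginal alpha s Y).
Proof.
move=> ha; have [pY|npY] := pselect (posdefmx (hermmx Y : 'M[C]_p)); last first.
  rewrite /joint_marginal mxgkernel_notposdef// mul0r.
  by apply: eq_has_cint (has_cint0 _) => t; rewrite /joint_kernel mxgkernel_notposdef// mul0r.
have := has_cintZ (mxgkernel s 1%:M Y)
  (has_cint_power (fun j => has_cint_mxgkernel pY (ha j))).
congr (has_cint _ _ _).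
rewrite big_split /= cpow_prod /joint_marginal mulrA; congr (_ * _).
rewrite !mxgkernel_posdef// mulrAC -cpowD sumrN; congr (cpow _ _ * _).
by rewrite addrAC.
Qed.

Lemma has_cint_joint_kernel alpha s : (forall j, p%:R - 1 < complex.Re (alpha j)) ->
  p%:R - 1 < complex.Re (s - \sum_j alpha j) ->
  has_cint (prodm (hm p) (power_measure (hm p) k)) (joint_kernel alpha s)
    (cmxGamma p (s - \sum_j alpha j) * \prod_j cmxGamma p (alpha j)).
Proof.
move=> ha hs.
have M al u : p%:R - 1 < complex.Re (u - \sum_j al j) ->
    has_cint (hm p) (joint_marginal al u)
      (cmxGamma p (u - \sum_j al j) * \prod_j cmxGamma p (al j)).
  move=> hu; apply: has_cintZr; have := has_cint_mxgkernel (posdef1 p) hu.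
  by rewrite /absdet det1 normr1 cpow1l mul1r.
pose al0 j : C := (complex.Re (alpha j))%:C; pose s0 : C := (complex.Re s)%:C.
have ha0 j : p%:R - 1 < complex.Re (al0 j) by exact: ha.
have hs0 : p%:R - 1 < complex.Re (s0 - \sum_j al0 j).
  suff <- : complex.Re (s - \sum_j alpha j) = complex.Re (s0 - \sum_j al0 j) by [].
  by rewrite [LHS]raddfB [RHS]raddfB; congr (_ - _); rewrite [LHS]raddf_sum [RHS]raddf_sum.
refine (@has_cint_prod _ _ _ _ R _ _ (joint_kernel alpha s) (joint_kernel al0 s0) _ _ _ _
  (cmeasurable_joint_kernel _ _) _ (fun Y => has_cint_joint_marginal _ _ ha0) (M _ _ hs0)
  (fun Y => has_cint_joint_marginal _ _ ha) (M _ _ hs)).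
by move=> z; exact: norm_joint_kernel.
Qed.

(** Integrating the joint kernel over Y first gives the wanted integrand times the constant
    Gamma_p(s), so both its integrability and its integral are read off from the joint kernel. *)
Lemma has_cint_dirichlet alpha s : (forall j, p%:R - 1 < complex.Re (alpha j)) ->
  p%:R - 1 < complex.Re s -> p%:R - 1 < complex.Re (s - \sum_j alpha j) ->
  has_cint (power_measure (hm p) k)
    (fun t => dirichlet_weight alpha t * cpow (absdet (1%:M + \sum_j hermtuple t j)) (- s))
    (cmxGamma p (s - \sum_j alpha j) * (\prod_j cmxGamma p (alpha j)) / cmxGamma p s).
Proof.
move=> ha hs0 hs; have Gs := cmxGamma_neq0 hs0.
have K := has_cint_joint_kernel ha hs.
have mS : cmeasurable (fun z : k.-tuple (hermcoord p) * hermcoord p => joint_kernel alpha s (swap z)).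
  exact: (@cmeasurable_comp _ _ _ _ R (joint_kernel alpha s) swap (@measurable_swap _ _ _ _)
    (cmeasurable_joint_kernel alpha s)).
have K' : has_cint (prodm (power_measure (hm p) k) (hm p))
    (fun z => joint_kernel alpha s (swap z))
    (cmxGamma p (s - \sum_j alpha j) * \prod_j cmxGamma p (alpha j)).
  apply: (has_cint_mpreserving (mpreserving_swap (hm p) (power_measure (hm p) k)) mS).
  by apply: eq_has_cint K => -[Y t].
have sec t : has_cint (hm p) (fun Y => joint_kernel alpha s (Y, t))
    (dirichlet_weight alpha t * cpow (absdet (1%:M + \sum_j hermtuple t j)) (- s) * cmxGamma p s).
  rewrite -mulrA.
  apply: (@eq_has_cint _ _ _ _ (fun Y => dirichlet_weight alpha t *
    mxgkernel s (1%:M + \sum_j hermtuple t j) Y)) => [Y|]; first by rewrite joint_kernelE.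
  (* The Gamma formula applies only where I + X_1 + ... + X_k is positive definite; off the domain
     the weight vanishes and makes the section zero. *)
  have [pt|npt] := pselect (forall j, posdefmx (hermtuple t j)).
    apply: has_cintZ; apply: has_cint_mxgkernel hs0.
    by apply: posdef_sum => //; exact: posdef1.
  have -> : dirichlet_weight alpha t = 0.
    move/existsNP : npt => [j npj]; rewrite /dirichlet_weight (bigD1 j)//=.
    by rewrite indicE memNset// !mul0r.
  rewrite mul0r; apply: eq_has_cint (has_cint0 _) => Y; by rewrite mul0r.
have := has_cintZr (cmxGamma p s)^-1 (has_cint_sections K' sec).
by apply: eq_has_cint => t; rewrite mulfK.
Qed.

End joint_kernel.

Lemma measurable_posdef_domain p k : measurable (@posdef_domain R p k).
Proof.
rewrite (_ : @posdef_domain R p k = \bigcap_(j in [set: 'I_k])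
    ((fun t : k.-tuple (@hermcoord R p) => tnth t j) @^-1` (@posdef_coord R p))).
  apply: fin_bigcap_measurable => // j _; rewrite -[X in measurable X]setTI.
  by apply: measurable_tnth => //; exact: measurable_posdef_coord.
by apply/seteqP; split => t h j => [_|]; [exact: h|exact: (h j Logic.I)].
Qed.

Lemma dirichlet_weight_indic p k (alpha : 'I_k -> C) t : dirichlet_weight alpha t =
  (\1_(@posdef_domain R p k) t)%:C * \prod_j cpow (absdet (hermtuple t j)) (alpha j - p%:R).
Proof.
rewrite /dirichlet_weight big_split /=; congr (_ * _).
have [pt|npt] := pselect (posdef_domain t).
  by rewrite indicE mem_set// big1// => j _; rewrite indicE mem_set//; exact: pt.
rewrite indicE memNset//; move/existsNP : npt => [j npj].
by rewrite (bigD1 j)//= indicE memNset// mul0r.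
Qed.

End dirichlet_integral.

Theorem mainTheorem5 (R : realType) (p k : nat) (alpha : 'I_k.+1 -> R[i])
    (delta : R[i]) (p_gt0 : (0 < p)%N) (k_gt0 : (0 < k)%N)
    (alpha_gt : forall j, p%:R - 1 < complex.Re (alpha j))
    (alphadelta_gt : p%:R - 1 < complex.Re (alpha ord_max + delta)) :
  dirichlet2_integrable alpha (@phi5 R p k delta) /\
  dirichlet2_average alpha (@phi5 R p k delta) =
    cmxGamma p (alpha ord_max + delta) / cmxGamma p (alpha ord_max) *
    (cmxGamma p (\sum_j alpha j) / cmxGamma p (\sum_j alpha j + delta)).
Proof.
pose al j := alpha (widen_ord (leqnSn k) j); pose s := \sum_j alpha j + delta.
have sumE : \sum_j alpha j = \sum_j al j + alpha ord_max by rewrite big_ord_recr.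
have sE : s - \sum_j al j = alpha ord_max + delta by rewrite /s sumE; ring.
have al_gt j : p%:R - 1 < complex.Re (al j) by exact: alpha_gt.
(* As p >= 1, the first k parameters have nonnegative real parts, so adding them to alpha_(k+1) +
   delta keeps the real part above p - 1. *)
have p1 : 0 <= (p%:R - 1 : R) by rewrite subr_ge0 ler1n.
have s_gt : p%:R - 1 < complex.Re s.
  have -> : s = \sum_j al j + (alpha ord_max + delta) by rewrite -sE addrC subrK.
  rewrite raddfD /= raddf_sum ltr_wpDl//; apply: sumr_ge0 => j _.
  exact: le_trans p1 (ltW (al_gt j)).
have G j : cmxGamma p (al j) != 0 by exact: cmxGamma_neq0.
have Gm : cmxGamma p (alpha ord_max) != 0 by exact: cmxGamma_neq0.
have Gs := cmxGamma_neq0 s_gt.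
have s'_gt : p%:R - 1 < complex.Re (s - \sum_j al j) by rewrite sE.
have := has_cintZ (dirichlet2_const p alpha) (has_cint_dirichlet al_gt s_gt s'_gt).
rewrite sE => H.
apply: (cintegral_restrict (@measurable_posdef_domain R p k)).
move: H; congr (has_cint _ _ _).
  apply/funext => t; rewrite dirichlet_weight_indic /dirichlet2_integrand /phi5 /dirichlet2_density.
  (* The factor [phi5] merges with the determinant power of the density into the single exponent
     -s. *)
  rewrite /s opprD cpowD.
  move: (dirichlet2_const _ _) (cpow _ (- delta)) (cpow _ (- \sum_j alpha j)) => x1 x2 x3.
  rewrite -/al.
  move: (\prod_j _) ((\1_ _ _)%:C) => x4 x5; ring.
have Gp : \prod_j cmxGamma p (al j) != 0 by apply/prodf_neq0 => j _; exact: G.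
have prodE : \prod_j cmxGamma p (alpha j) =
    \prod_j cmxGamma p (al j) * cmxGamma p (alpha ord_max) by rewrite big_ord_recr.
rewrite /dirichlet2_const prodE -/s.
move: (\prod_j cmxGamma p (al j)) (cmxGamma p (alpha ord_max)) (cmxGamma p s)
  (cmxGamma p (\sum_j alpha j)) (cmxGamma p (alpha ord_max + delta)) Gp Gm Gs.
by move=> x1 x2 x3 x4 x5 h1 h2 h3; field; rewrite h1 h2 h3.
Qed.
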